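(* Let $\gamma>\frac12$, $T>0$, let $\mathcal{D}\subset\mathbb{R}^d$, and let $A$ and $Q$ be linear operators on $\mathcal{L}^2(\mathcal{D})$ such that: (i) $A$ and $Q$ have a joint orthonormal basis of eigenfunctions $\{e_k\}_{k=1}^\infty$ spanning $\mathcal{L}^2(\mathcal{D})$, with real eigenvalues $\{\mu_k\}_{k=1}^\infty$ (of $A$) and $\{\lambda_k\}_{k=1}^\infty$ (of $Q$); (ii) there are $r_\mu>0$ and $C_1>0$ with $\mu_k\ge C_1k^{r_\mu}$ for all $k$, the $\mu_k$ being non-decreasing in $k$; (iii) there are $r_\lambda<0$ and $C_2>0$ with $0<\lambda_k\le C_2k^{r_\lambda}$ for all $k$, the $\lambda_k$ being non-increasing in $k$. Let $c_k(t)$, $X(t)$ and $\tilde X_M(t)$ be as defined in the context. If $1+r_\lambda-(2\gamma-1)r_\mu<0$, then for all $t\in[0,T]$ we have $X(t)=\sum_{k=1}^\infty c_k(t)e_k\in\mathcal{L}^2(\Omega,\mathcal{L}^2(\mathcal{D}))$ and, for every $M\ge1$, $$\mathbb{E}\left[\|X(t)-\tilde X_M(t)\|^2\right]\le C\,M^{-\frac{2\nu}{d}},$$ where $\nu=-\frac d2\left(1+r_\lambda-(2\gamma-1)r_\mu\right)$ and $C=\dfrac{C_2\,\Gamma(2\gamma-1)}{C_1^{2\gamma-1}\,\Gamma(\gamma)^2}\,\dfrac{d}{2\nu}$.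
   Context: $\|\cdot\|$ and $\langle\cdot,\cdot\rangle$ are the norm and inner product of $\mathcal{L}^2(\mathcal{D})$; $\Omega$ is the underlying probability space; $\Gamma$ is the gamma function. $W_Q$ is a (generalised) $Q$-Wiener process and $S(t)=\mathrm{e}^{-tA}$ is the $C_0$-semigroup with $S(t)e_k=\mathrm{e}^{-\mu_kt}e_k$. $X$ is the stochastic convolution $X(t)=\frac{1}{\Gamma(\gamma)}\int_0^t(t-s)^{\gamma-1}S(t-s)\,\mathrm{d}W_Q(s)$, $t\ge0$, which is the mild solution of $(\partial_t+A)^\gamma X=\dot W_Q$ with $X(t)=0$ for $t\le 0$. It is expanded as $X(t)=\sum_{k=1}^\infty c_k(t)e_k$, where $c_k(t)=\frac{\sqrt{\lambda_k}}{\Gamma(\gamma)}\int_0^t\mathrm{e}^{-\mu_k(t-s)}(t-s)^{\gamma-1}\,\mathrm{d}\omega_k(s)$ and $\omega_k(t)=\lambda_k^{-1/2}\langle W_Q(t),e_k\rangle$, $k=1,2,\dots$, are independent real-valued standard Wiener processes. The spectral truncation is $\tilde X_M(t)=\sum_{k=1}^Mc_k(t)e_k$. *)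

(* Defs.v *)
From HB Require Import structures.
From mathcomp Require Import all_boot all_order all_algebra.
From mathcomp Require Import all_classical all_reals all_analysis.

Set Implicit Arguments.
Unset Strict Implicit.
Unset Printing Implicit Defensive.

Import Order.TTheory GRing.Theory Num.Theory.
Import numFieldNormedType.Exports.

Local Open Scope classical_set_scope.
Local Open Scope ring_scope.

(* Lebesgue measure on R^n, points of R^n being n-tuples: the image under
   (x, v) |-> x :: v of the product of the one-dimensional measures. *)
Section lebesgue_measure_cons.
Context {R : realType} (n : nat).
Variable m : {sigma_finite_measure set (n.-tuple R) -> \bar R}.

Definition tuple_cons (p : measurableTypeR R * n.-tuple R) : n.+1.-tuple R :=
  [tuple of (p.1 : R) :: p.2].

Let tuple_uncons (t : n.+1.-tuple R) : measurableTypeR R * n.-tuple R :=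
  (thead t, [tuple of behead t]).

Let tuple_consK : cancel tuple_cons tuple_uncons.
Proof. by case=> a t; rewrite /tuple_uncons theadE; congr pair; apply/val_inj. Qed.

Let measurable_tuple_cons : measurable_fun setT tuple_cons.
Proof.
apply: (@measurable_cons _ _ (measurableTypeR R * n.-tuple R)%type R
  (fun p => p.1) n (fun p => p.2)).
- exact: measurable_fst.
- exact: measurable_snd.
Qed.

Let measurable_tuple_uncons : measurable_fun setT tuple_uncons.
Proof.
apply/measurable_fun_pairP; split; first exact: measurable_tnth.
exact: measurable_behead.
Qed.

Definition lebesgue_measure_cons : set (n.+1.-tuple R) -> \bar R :=
  pushforward (lebesgue_measure \x m)%E tuple_cons.

Let cons0 : lebesgue_measure_cons set0 = 0%E.
Proof. by rewrite /lebesgue_measure_cons /pushforward preimage_set0 measure0. Qed.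

Let cons_ge0 A : (0 <= lebesgue_measure_cons A)%E.
Proof. exact: measure_ge0. Qed.

Let cons_sigma_additive : semi_sigma_additive lebesgue_measure_cons.
Proof.
move=> F mF tF mUF; rewrite /lebesgue_measure_cons /pushforward preimage_bigcup.
apply: measure_semi_sigma_additive.
- by move=> i; rewrite -[X in measurable X]setTI; exact: measurable_tuple_cons.
- apply/trivIsetP => /= i j _ _ ij; rewrite -preimage_setI.
  by move/trivIsetP : tF => /(_ _ _ _ _ ij) ->//; rewrite preimage_set0.
- by rewrite -preimage_bigcup -[X in measurable X]setTI; exact: measurable_tuple_cons.
Qed.

HB.instance Definition _ := isMeasure.Build _ _ _ lebesgue_measure_cons
  cons0 cons_ge0 cons_sigma_additive.

Let cons_sigma_finite : sigma_finite setT lebesgue_measure_cons.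
Proof.
have [H TH mH] : sigma_finite setT (lebesgue_measure \x m)%E.
  have /sigma_finiteP[F [TF ndF Foo]] := sigma_finiteT (@lebesgue_measure R).
  have /sigma_finiteP[G [TG ndG Goo]] := sigma_finiteT m.
  exists (fun i => F i `*` G i) => [|i].
    rewrite -setXTT TF TG predeqE => -[x y]; split.
      move=> [/= [i _ Fx] [j _ Gy]]; exists (maxn i j) => //; split.
      - by move: x Fx; exact/subsetPset/ndF/leq_maxl.
      - by move: y Gy; exact/subsetPset/ndG/leq_maxr.
    by move=> [i _ []/= ? ?]; split; exists i.
  have [? ?] := Foo i; have [? ?] := Goo i; split; first exact: measurableX.
  by rewrite product_measure1E// lte_mul_pinfty// ge0_fin_numE.
exists (fun i => tuple_uncons @^-1` H i).
  by rewrite -preimage_bigcup -TH preimage_setT.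
move=> i; have [mHi Hi] := mH i; split.
  by rewrite -[X in measurable X]setTI; exact: measurable_tuple_uncons.
rewrite /lebesgue_measure_cons /pushforward -comp_preimage.
by rewrite (_ : tuple_uncons \o tuple_cons = id)//; apply/funext.
Qed.

HB.instance Definition _ := Measure_isSigmaFinite.Build _ _ _
  lebesgue_measure_cons cons_sigma_finite.

End lebesgue_measure_cons.

Fixpoint lebesgue_measure_tuple (R : realType) (n : nat) :
    {sigma_finite_measure set (n.-tuple R) -> \bar R} :=
  match n with
  | 0 => \d_([tuple] : 0.-tuple R)
  | n'.+1 => lebesgue_measure_cons (lebesgue_measure_tuple R n')
  end.

Definition lebesgue_on (R : realType) (n : nat) (D : set (n.-tuple R))
    (mD : measurable D) : {measure set (n.-tuple R) -> \bar R} :=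
  mrestr (lebesgue_measure_tuple R n) mD.

Definition Gamma {R : realType} (a : R) : R :=
  \int[lebesgue_measure]_(x in `]0, +oo[) (x `^ (a - 1) * expR (- x)).

(* Elements of L2 mu are square-integrable functions, not classes: equality in
   the Hilbert space is equality almost everywhere, and all the notions below
   are insensitive to the choice of representatives. *)
Definition L2 d (T : measurableType d) (R : realType)
  (mu : {measure set T -> \bar R}) := LfunType mu (lee1n 2 : (1 <= 2%:E :> \bar R)%E).

Section L2_operators.
Context d (T : measurableType d) (R : realType).
Variable mu : {measure set T -> \bar R}.
Local Notation H := (L2 mu).

Definition L2_inner (f g : H) : R := \int[mu]_x (f x * g x).

Definition L2_norm (f : H) : R := fine ('N[mu]_(2%:E)[EFin \o f])%E.

Definition L2_open (U : set H) : Prop :=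
  forall f, U f -> exists2 r : R, 0 < r & forall g, L2_norm (g - f) < r -> U g.

Definition orthonormal_basis (e : nat -> H) : Prop :=
  (forall i j, L2_inner (e i) (e j) = (i == j)%:R) /\
  (forall (f : H) (eps : R), 0 < eps ->
     exists n (a : nat -> R), L2_norm (f - \sum_(i < n) a i *: e i) < eps).

(* A possibly unbounded linear operator, given by its domain and its values
   there; off the domain, [A] is arbitrary. *)
Record linear_operator (dom : set H) (A : H -> H) : Prop := {
  linop_dom0 : dom 0 ;
  linop_domP : forall (a : R) f g, dom f -> dom g -> dom (a *: f + g) ;
  linop_dom_ae : forall f g : H, dom f -> f = g %[ae mu] -> dom g ;
  linop_linear : forall (a : R) f g, dom f -> dom g ->
    A (a *: f + g) = a *: A f + A g %[ae mu] ;
  linop_ae : forall f g : H, dom f -> f = g %[ae mu] -> A f = A g %[ae mu] }.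

Definition eigenvector (dom : set H) (A : H -> H) (a : R) (f : H) : Prop :=
  dom f /\ A f = a *: f %[ae mu].

Record C0_semigroup (S : R -> H -> H) : Prop := {
  semigroup_linear : forall t, 0 <= t -> linear_operator setT (S t) ;
  semigroup_bounded : forall t, 0 <= t ->
    exists K : R, forall f, L2_norm (S t f) <= K * L2_norm f ;
  semigroup_0 : forall f, S 0 f = f %[ae mu] ;
  semigroup_add : forall s t f, 0 <= s -> 0 <= t ->
    S (s + t) f = S s (S t f) %[ae mu] ;
  semigroup_cvg : forall f, L2_norm (S t f - f) @[t --> 0^'+] --> (0 : R) }.

End L2_operators.

Section random_elements.
Context d (T : measurableType d) (R : realType).
Variable mu : {measure set T -> \bar R}.
Local Notation H := (L2 mu).
Context d' (Omega : measurableType d').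
Variable P : probability Omega R.

Definition L2_measurable (X : Omega -> H) : Prop :=
  forall U, L2_open U -> measurable (X @^-1` U).

Definition mean_square_norm (X : Omega -> H) : \bar R :=
  'E_P[fun w => (L2_norm (X w) ^+ 2)%R]%E.

Definition L2_random (X : Omega -> H) : Prop :=
  L2_measurable X /\ (mean_square_norm X < +oo)%E.

(* [normal_prob 0 0] is not a Dirac mass in the library, hence the case
   distinction. *)
Definition centered_gaussian (Y : Omega -> R) (v : R) : Prop :=
  measurable_fun setT Y /\
  forall A : set R, measurable A ->
    P (Y @^-1` A) = if v == 0 then \d_(0 : R) A else normal_prob 0 (Num.sqrt v) A.

(* [W t f] stands for <W_Q(t), f>. When Q is not of trace class, W_Q(t) is not
   an element of H and only these pairings are defined. *)
Record generalised_Q_wiener (Q : H -> H) (W : R -> H -> Omega -> R) : Prop := {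
  wiener_linear : forall t (a : R) f g, 0 <= t ->
    W t (a *: f + g) = (fun w => a * W t f w + W t g w) %[ae P] ;
  wiener_gaussian : forall s : seq (R * H), (forall p, p \in s -> 0 <= p.1) ->
    centered_gaussian (fun w => \sum_(p <- s) W p.1 p.2 w)
      (\sum_(p <- s) \sum_(q <- s) Num.min p.1 q.1 * L2_inner (Q p.2) q.2) ;
  wiener_covariance : forall s t f g, 0 <= s -> 0 <= t ->
    'E_P[fun w => (W s f w * W t g w)%R]%E = (Num.min s t * L2_inner (Q f) g)%:E ;
  wiener_continuous : forall f,
    {ae P, forall w, {within `[0, +oo[, continuous (fun t => W t f w)}} }.

(* omega_k = lam_k^(-1/2) <W_Q, e_k> *)
Definition coordinate_wiener (W : R -> H -> Omega -> R) (e : nat -> H)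
    (lam : nat -> R) (k : nat) : R -> Omega -> R :=
  fun t w => (Num.sqrt (lam k))^-1 * W t (e k) w.

(* The triple ((l, r), a) stands for the step function equal to a on ]l, r]. *)
Definition step_eval (phi : seq (R * R * R)) (s : R) : R :=
  \sum_(p <- phi | p.1.1 < s <= p.1.2) p.2.

Definition step_integral (B : R -> Omega -> R) (phi : seq (R * R * R))
    (w : Omega) : R :=
  \sum_(p <- phi) p.2 * (B p.1.2 w - B p.1.1 w).

(* [I] is the integral of the deterministic function [f] over [0, t] with
   respect to the Wiener process [B]. *)
Definition wiener_integral (B : R -> Omega -> R) (t : R) (f : R -> R)
    (I : Omega -> R) : Prop :=
  [/\ measurable_fun `[0, t] f, measurable_fun setT I &
  exists phi : nat -> seq (R * R * R),
  [/\ forall n p, p \in phi n -> 0 <= p.1.1 <= p.1.2 /\ p.1.2 <= t,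
      (\int[lebesgue_measure]_(s in `[0%R, t])
         ((f s - step_eval (phi n) s) ^+ 2)%:E)%E @[n --> \oo] --> 0%E &
      'E_P[fun w => ((I w - step_integral B (phi n) w) ^+ 2)%R]%E
        @[n --> \oo] --> 0%E]].

(* ((l, r), (h, g)) stands for the elementary integrand with value
   the rank-one operator x |-> <h, x> g on ]l, r]. *)
Definition elementary_eval (Phi : seq (R * R * (H * H))) (s : R) (x : H) : H :=
  \sum_(p <- Phi | p.1.1 < s <= p.1.2) L2_inner p.2.1 x *: p.2.2.

Definition elementary_integral (W : R -> H -> Omega -> R)
    (Phi : seq (R * R * (H * H))) (w : Omega) : H :=
  \sum_(p <- Phi) (W p.1.2 p.2.1 w - W p.1.1 p.2.1 w) *: p.2.2.

(* The squared Hilbert-Schmidt norm of B Q^(1/2), computed in the eigenbasis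
   [e] of Q, in which Q^(1/2) e_k = sqrt (lam k) e_k. *)
Definition hilbert_schmidt_sqr (e : nat -> H) (lam : nat -> R) (B : H -> H) :
    \bar R :=
  (\sum_(0 <= k <oo) (lam k * L2_norm (B (e k)) ^+ 2)%:E)%E.

(* [J] is the Ito integral over [0, t] of the deterministic operator-valued
   function [Phi] with respect to the generalised Q-Wiener process [W]. *)
Definition stochastic_integral (e : nat -> H) (lam : nat -> R)
    (W : R -> H -> Omega -> R) (t : R) (Phi : R -> H -> H)
    (J : Omega -> H) : Prop :=
  [/\ forall k f, measurable_fun `[0, t] (fun s => L2_inner (Phi s (e k)) f),
      L2_measurable J &
  exists Psi : nat -> seq (R * R * (H * H)),
  [/\ forall n p, p \in Psi n -> 0 <= p.1.1 <= p.1.2 /\ p.1.2 <= t,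
      (\int[lebesgue_measure]_(s in `[0%R, t])
         hilbert_schmidt_sqr e lam
           (fun x => Phi s x - elementary_eval (Psi n) s x)%R)%E
        @[n --> \oo] --> 0%E &
      mean_square_norm (fun w => J w - elementary_integral W (Psi n) w)
        @[n --> \oo] --> 0%E]].

Definition stochastic_convolution (gamma : R) (S : R -> H -> H) (e : nat -> H)
    (lam : nat -> R) (W : R -> H -> Omega -> R) (t : R) (X : Omega -> H) : Prop :=
  exists2 J : Omega -> H,
    stochastic_integral e lam W t
      (fun s x => (t - s) `^ (gamma - 1) *: S (t - s) x) J &
    forall w, X w = (Gamma gamma)^-1 *: J w.

Definition spectral_coefficient (gamma : R) (mu_ lam : nat -> R) (e : nat -> H)
    (W : R -> H -> Omega -> R) (k : nat) (t : R) (c : Omega -> R) : Prop :=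
  exists2 I : Omega -> R,
    wiener_integral (coordinate_wiener W e lam k) t
      (fun s => expR (- (mu_ k * (t - s))) * (t - s) `^ (gamma - 1)) I &
    forall w, c w = Num.sqrt (lam k) / Gamma gamma * I w.

Definition spectral_truncation (e : nat -> H) (c : nat -> R -> Omega -> R)
    (M : nat) (t : R) (w : Omega) : H :=
  \sum_(k < M) c k t w *: e k.

End random_elements.

(* Main.v *)
Require Import Defs.
From HB Require Import structures.
From mathcomp Require Import all_boot all_order all_algebra.
From mathcomp Require Import all_classical all_reals all_analysis.
From mathcomp Require Import measurable_realfun ring lra.

(* In the eigenbasis e_k the noise splits into the processes <W_Q, e_k>. The
   covariance of W_Q gives an Ito isometry for elementary integrands, with
   <Q f, g> expanded by Parseval in the e_j; it identifies <J, e_k>, for the Ito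
   integral J defining X, with the Wiener integral defining c_k. Hence
   <X, e_k> = c_k almost surely, and Parseval and Tonelli turn the truncation
   error into the tail of the sum of the
     E c_k^2 <= lam_k Gamma(gamma)^-2 int_0^oo exp(- 2 mu_k u) u^(2 gamma - 2) du,
   which is O(k^(r_lam - (2 gamma - 1) r_mu)); the tail is compared with an
   integral. For the existence of X, Riesz-Fischer sums c_k e_k pointwise in
   Omega, and the step functions approximating the kernels of c_0, ..., c_(n-1)
   provide the elementary integrands. *)

Set Implicit Arguments.
Unset Strict Implicit.
Unset Printing Implicit Defensive.

Import Order.TTheory GRing.Theory Num.Theory.
Import numFieldNormedType.Exports.

Local Open Scope classical_set_scope.
Local Open Scope ring_scope.

(** * The Hilbert space L2 *)

(** Elements of [L2 mu] are functions rather than classes, so the inner product is only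
    semi-definite: identities in the Hilbert space are obtained as vanishing norms and turned into
    almost everywhere equalities when needed. The approximants of J and those of the Wiener integral
    in c_k are unrelated sequences. They can be compared because one isometry covers every finite
    list of increments of W, in arbitrary directions, and the difference of two such lists is again
    one. The kernel may be singular at s = t, and gamma > 1/2 makes its square integrable. In the
    constant C, the factor Gamma(2 gamma - 1) / C1^(2 gamma - 1) comes from bounding exp(- 2 mu_k u)
    by exp(- mu_k u), which explains the absence of a power of 2; the factor d / (2 nu) is 1 / p for
    terms decaying like k^(- (p + 1)), where p = 2 nu / d. *)

Section L2_theory.
Context d (T : measurableType d) (R : realType).
Variable mu : {measure set T -> \bar R}.
Local Notation H := (L2 mu).
Implicit Types f g h : H.

Lemma L2_mul_integrable f g :
  mu.-integrable setT (EFin \o (fun x => f x * g x)).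
Proof. by apply/Lfun1_integrable/Lfun2_mul_Lfun1; exact: LfunP. Qed.

Lemma EFin_L2_inner f g :
  (L2_inner f g)%:E = (\int[mu]_x (f x * g x)%:E)%E.
Proof.
by rewrite /L2_inner /Rintegral fineK//; apply: integrable_fin_num => //;
  exact: L2_mul_integrable.
Qed.

Lemma L2_innerC f g : L2_inner f g = L2_inner g f.
Proof. by apply: eq_Rintegral => x _; rewrite mulrC. Qed.

Lemma L2_innerDl f g h : L2_inner (f + g) h = L2_inner f h + L2_inner g h.
Proof.
rewrite /L2_inner -RintegralD//; try exact: L2_mul_integrable.
by apply: eq_Rintegral => x _; rewrite -mulrDl.
Qed.

Lemma L2_innerZl a f g : L2_inner (a *: f) g = a * L2_inner f g.
Proof.
rewrite /L2_inner -RintegralZl//; last exact: L2_mul_integrable.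
by apply: eq_Rintegral => x _; rewrite mulrA.
Qed.

Lemma L2_inner0l f : L2_inner 0 f = 0.
Proof. by rewrite -[X in L2_inner X](scale0r 0) L2_innerZl mul0r. Qed.

Lemma L2_innerNl f g : L2_inner (- f) g = - L2_inner f g.
Proof. by rewrite -scaleN1r L2_innerZl mulN1r. Qed.

Lemma L2_innerBl f g h : L2_inner (f - g) h = L2_inner f h - L2_inner g h.
Proof. by rewrite L2_innerDl L2_innerNl. Qed.

Lemma L2_innerDr f g h : L2_inner h (f + g) = L2_inner h f + L2_inner h g.
Proof. by rewrite L2_innerC L2_innerDl !(L2_innerC h). Qed.

Lemma L2_innerZr a f g : L2_inner f (a *: g) = a * L2_inner f g.
Proof. by rewrite L2_innerC L2_innerZl L2_innerC. Qed.

Lemma L2_innerNr f g : L2_inner f (- g) = - L2_inner f g.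
Proof. by rewrite L2_innerC L2_innerNl L2_innerC. Qed.

Lemma L2_innerBr f g h : L2_inner h (f - g) = L2_inner h f - L2_inner h g.
Proof. by rewrite L2_innerDr L2_innerNr. Qed.

Lemma L2_inner_suml (I : Type) (r : seq I) (P : pred I) (F : I -> H) g :
  L2_inner (\sum_(i <- r | P i) F i) g = \sum_(i <- r | P i) L2_inner (F i) g.
Proof.
apply: (big_morph (fun f => L2_inner f g)); first by move=> x y; rewrite L2_innerDl.
exact: L2_inner0l.
Qed.

Lemma L2_inner_sumr (I : Type) (r : seq I) (P : pred I) (F : I -> H) g :
  L2_inner g (\sum_(i <- r | P i) F i) = \sum_(i <- r | P i) L2_inner g (F i).
Proof. by rewrite L2_innerC L2_inner_suml; under eq_bigr do rewrite L2_innerC. Qed.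

Lemma L2_norm_sqrE f : L2_norm f ^+ 2 = L2_inner f f.
Proof.
apply/EFin_inj; rewrite EFin_L2_inner.
rewrite -powR_mulrn; last by rewrite /L2_norm fine_ge0// Lnorm_ge0.
rewrite -poweR_EFin /L2_norm finite_norm_fine poweR_Lnorm//.
by apply: eq_integral => x _ /=; rewrite powR_mulrn// real_normK ?num_real// expr2.
Qed.

Lemma EFin_L2_norm_sqr f :
  (L2_norm f ^+ 2)%:E = (\int[mu]_x (f x ^+ 2)%:E)%E.
Proof. by rewrite L2_norm_sqrE EFin_L2_inner; under eq_integral do rewrite -expr2. Qed.

Lemma L2_norm_ge0 f : 0 <= L2_norm f.
Proof. by rewrite /L2_norm fine_ge0// Lnorm_ge0. Qed.

Lemma L2_norm_sqrt f : L2_norm f = Num.sqrt (L2_inner f f).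
Proof. by rewrite -L2_norm_sqrE sqrtr_sqr ger0_norm// L2_norm_ge0. Qed.

Lemma ler_L2_normD f g : L2_norm (f + g) <= L2_norm f + L2_norm g.
Proof. exact: ler_LnormD. Qed.

Lemma L2_normZ a f : L2_norm (a *: f) = `|a| * L2_norm f.
Proof.
by rewrite !L2_norm_sqrt L2_innerZl L2_innerZr mulrA -expr2 sqrtrM ?sqr_ge0// sqrtr_sqr.
Qed.

Lemma L2_normN f : L2_norm (- f) = L2_norm f.
Proof. by rewrite -scaleN1r L2_normZ normrN1 mul1r. Qed.

Lemma L2_norm0 : L2_norm (0 : H) = 0.
Proof. by rewrite -[X in L2_norm X](scale0r 0) L2_normZ normr0 mul0r. Qed.

Lemma L2_normBC f g : L2_norm (f - g) = L2_norm (g - f).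
Proof. by rewrite -opprB L2_normN. Qed.

Lemma ler_L2_normB f g : L2_norm f - L2_norm g <= L2_norm (f - g).
Proof. by rewrite lerBlDr (le_trans _ (ler_L2_normD _ _))// subrK. Qed.

Lemma ler_dist_L2_norm f g : `|L2_norm f - L2_norm g| <= L2_norm (f - g).
Proof.
rewrite ler_norml ler_L2_normB andbT lerNl opprB.
by rewrite L2_normBC; exact: ler_L2_normB.
Qed.

(** A null norm does not make g the zero function, hence a separate case: there |f + x g|^2 is
    affine in x and nonnegative, so its slope vanishes. *)
Lemma L2_cauchy_schwarz f g : `|L2_inner f g| <= L2_norm f * L2_norm g.
Proof.
have [g0|g0] := eqVneq (L2_norm g) 0.
  have q x : 0 <= L2_inner f f + x * L2_inner f g *+ 2.
    have := sqr_ge0 (L2_norm (f + x *: g)).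
    rewrite L2_norm_sqrE L2_innerDl !L2_innerDr !L2_innerZl !L2_innerZr.
    by rewrite -!(L2_norm_sqrE g) g0 (L2_innerC g f) expr0n/= !mulr0 addr0 -addrA
      -mulr2n.
  rewrite g0 mulr0 normr_le0; apply/eqP; apply: contrapT => /eqP n0.
  (* At this x the affine function equals - <f, f> - 2, which is negative. *)
  have := q (- (L2_inner f f + 1) / L2_inner f g).
  have := sqr_ge0 (L2_norm f); rewrite L2_norm_sqrE => ff.
  by rewrite divfK// => ?; lra.
have gp : 0 < L2_norm g by rewrite lt0r g0 L2_norm_ge0.
have := sqr_ge0 (L2_norm (L2_norm g ^+ 2 *: f - L2_inner f g *: g)).
rewrite [leRHS]L2_norm_sqrE L2_innerBl !L2_innerBr !L2_innerZl !L2_innerZr.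
rewrite -(L2_norm_sqrE f) -(L2_norm_sqrE g) (L2_innerC g f).
set a := L2_norm f; set b := L2_norm g; set c := L2_inner f g => h.
have {}h : 0 <= b ^+ 2 * ((a * b) ^+ 2 - c ^+ 2).
  by apply: le_trans h _; rewrite le_eqVlt; apply/orP; left; apply/eqP; ring.
rewrite pmulr_rge0 ?exprn_gt0// subr_ge0 in h.
by rewrite -[leRHS]ger0_norm ?mulr_ge0 ?L2_norm_ge0// -ler_sqr ?nnegrE// !real_normK
  ?num_real.
Qed.

Lemma eq_ae_L2_inner f g h : f = g %[ae mu] -> L2_inner f h = L2_inner g h.
Proof.
move=> fg; apply/EFin_inj; rewrite !EFin_L2_inner.
apply: ae_eq_integral => //.
- by case/integrableP : (L2_mul_integrable f h).
- by case/integrableP : (L2_mul_integrable g h).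
- by apply: filterS fg => x /(_ I) + _ => ->.
Qed.

Lemma eq_ae_L2_norm f g : f = g %[ae mu] -> L2_norm f = L2_norm g.
Proof.
move=> fg; rewrite !L2_norm_sqrt; congr Num.sqrt.
by rewrite (eq_ae_L2_inner _ fg) L2_innerC (eq_ae_L2_inner _ fg).
Qed.

Lemma L2_norm_eq0 f : L2_norm f = 0 -> f = 0 %[ae mu].
Proof. exact: fine_Lnormr_eq0. Qed.

Lemma L2_normDsqr f g :
  L2_norm (f + g) ^+ 2 <= 2 * L2_norm f ^+ 2 + 2 * L2_norm g ^+ 2.
Proof.
have := sqr_ge0 (L2_norm (f - g)).
rewrite !L2_norm_sqrE !(L2_innerBl, L2_innerBr, L2_innerDl, L2_innerDr) (L2_innerC g f).
by move=> ?; lra.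
Qed.

Lemma mem_Lfun2 (u : T -> R) : measurable_fun setT u ->
  (\int[mu]_x (u x ^+ 2)%:E < +oo)%E -> u \in Lfun mu 2%:E.
Proof.
move=> mu_ iu; rewrite inE; apply/andP; split; rewrite inE//=.
rewrite /finite_norm unlock poweR_lty//.
rewrite (eq_integral (fun x => (u x ^+ 2)%:E))// => x _ /=.
by rewrite powR_mulrn// real_normK ?num_real.
Qed.

End L2_theory.

Lemma nneseries_le (R : realType) (u : (\bar R)^nat) (B : \bar R) :
  (forall k, 0 <= u k)%E -> (forall n, \sum_(k < n) u k <= B)%E ->
  (\sum_(0 <= k <oo) u k <= B)%E.
Proof.
move=> u0 uB; apply: lime_le; first by apply: is_cvg_nneseries => n _ _; exact: u0.
by apply: nearW => n; rewrite big_mkord.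
Qed.

Lemma nneseries_ge (R : realType) (u : (\bar R)^nat) n :
  (forall k, 0 <= u k)%E -> (\sum_(k < n) u k <= \sum_(0 <= k <oo) u k)%E.
Proof.
move=> u0; rewrite -(big_mkord xpredT u).
exact: (@nneseries_lim_ge _ u xpredT 0%N n).
Qed.

Lemma limn_einf_le (R : realType) (u : (\bar R)^nat) (B : \bar R) :
  (forall n, u n <= B)%E -> (limn_einf u <= B)%E.
Proof.
move=> uB; rewrite limn_einf_lim; apply: lime_le; first exact: is_cvg_einfs.
by apply: nearW => n; apply: le_trans (uB n); apply: ereal_inf_lbound; exists n => /=.
Qed.

Lemma sum_half_le (R : realFieldType) n : \sum_(k < n) 2^-1 ^+ k <= 2 :> R.
Proof.
suff -> : \sum_(k < n) 2^-1 ^+ k = 2 - 2 * 2^-1 ^+ n :> R.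
  by rewrite gerBl mulr_ge0// exprn_ge0.
elim: n => [|n IH]; first by rewrite big_ord0 expr0; lra.
by rewrite big_ord_recr/= IH exprS; lra.
Qed.

(** * Completeness of L2 along sequences with geometric increments *)

Section L2_complete.
Context d (T : measurableType d) (R : realType).
Variable mu : {measure set T -> \bar R}.
Local Notation H := (L2 mu).
Variable u : nat -> H.
Hypothesis u_fast : forall n, L2_norm (u n.+1 - u n) <= 2^-1 ^+ n.

Lemma fast_L2_dist n m : L2_norm (u (m + n)%N - u n) <= 2 * 2^-1 ^+ n.
Proof.
(* The exact geometric sum is a bound that the induction on m can carry. *)
suff : L2_norm (u (m + n)%N - u n) <= 2 * 2^-1 ^+ n - 2 * 2^-1 ^+ (m + n).
  by move=> /le_trans; apply; rewrite gerBl mulr_ge0// exprn_ge0.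
elim: m => [|m IH]; first by rewrite add0n !subrr L2_norm0.
rewrite addSn -(subrK (u (m + n)%N) (u _.+1)) -addrA.
rewrite (le_trans (ler_L2_normD _ _))// (le_trans (lerD (u_fast _) IH))//.
by rewrite exprS; lra.
Qed.

(* |a| <= 2^-n + 2^n a^2 turns the L2 bounds on the increments into pointwise
   summability. *)
Lemma fast_L2_cvg_ae : {ae mu, forall x, cvgn (fun n => u n x)}.
Proof.
pose v n (x : T) : \bar R := ((2 ^+ n)%:E * ((u n.+1 x - u n x) ^+ 2)%:E)%E.
have v0 n x : (0 <= v n x)%E by rewrite /v -EFinM lee_fin mulr_ge0 ?sqr_ge0 ?exprn_ge0.
have mv n : measurable_fun setT (v n).
  apply/measurable_EFinP; apply: measurable_funM => //.
  by apply: measurable_funX; exact: measurable_funB.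
have iv n : (\int[mu]_x v n x <= (2^-1 ^+ n)%:E)%E.
  rewrite /v ge0_integralZl_EFin//.
  - rewrite -(@EFin_L2_norm_sqr _ _ _ mu (u n.+1 - u n)) -EFinM lee_fin.
    have h : L2_norm (u n.+1 - u n) ^+ 2 <= (2^-1 ^+ n) ^+ 2.
      by rewrite ler_sqr ?nnegrE ?L2_norm_ge0 ?exprn_ge0.
    apply: (@le_trans _ _ (2 ^+ n * (2^-1 ^+ n) ^+ 2));
      first by apply: ler_wpM2l => //; exact: exprn_ge0.
    rewrite expr2 mulrA -exprMn divff//.
    by rewrite expr1n mul1r.
  - by move=> x _; rewrite lee_fin sqr_ge0.
  - apply/measurable_EFinP; apply: measurable_funX; exact: measurable_funB.
have sv : (\int[mu]_x (\sum_(0 <= n <oo) v n x) < +oo)%E.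
  rewrite integral_nneseries//.
  apply: (@le_lt_trans _ _ (2%:E)); last exact: ltry.
  apply: nneseries_le => [k|n]; first exact: integral_ge0.
  apply: (@le_trans _ _ (\sum_(k < n) (2^-1 ^+ k)%:E)%E); first exact: lee_sum.
  rewrite sumEFin lee_fin; exact: sum_half_le.
have iv' : mu.-integrable setT (fun x => \sum_(0 <= n <oo) v n x)%E.
  apply/integrableP; split; first exact: ge0_emeasurable_sum.
  rewrite (eq_integral (fun x => \sum_(0 <= n <oo) v n x)%E)// => x _.
  by rewrite gee0_abs// nneseries_ge0.
have := integrable_ae measurableT iv'; apply: filterS => x /(_ I) fin.
have vB n : \sum_(k < n) 2 ^+ k * (u k.+1 x - u k x) ^+ 2 <= fine (\sum_(0 <= n <oo)
  v n x)%E.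
  rewrite -lee_fin fineK// -sumEFin.
  by apply: le_trans (nneseries_ge n _); [apply: lee_sum => k _; rewrite /v -EFinM|].
have cd : cvgn (series (telescope (fun n => u n x))).
  apply: normed_cvg; apply: nondecreasing_is_cvgn.
    by apply/nondecreasing_series => n _ _ /=.
  exists (2 + fine (\sum_(0 <= n <oo) v n x)%E) => _ [n _ <-].
  rewrite /normed_series_of /series/= big_mkord.
  apply: (@le_trans _ _ (\sum_(k < n) (2^-1 ^+ k + 2 ^+ k * (u k.+1 x - u k x) ^+ 2))).
    apply: ler_sum => k _; rewrite /telescope/=.
    set a := u k.+1 x - u k x; set b := 2 ^+ k; rewrite exprVn -/b.
    have b0 : 0 < b by rewrite exprn_gt0.
    rewrite -(ler_pM2l b0) mulrDr mulfV ?gt_eqF// mulrA -expr2 -(real_normK (num_real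
      a)).
    have := sqr_ge0 (b * `|a| - 1); have : 0 <= b * `|a| by rewrite mulr_ge0// ltW.
    by rewrite -exprMn; set z := b * _; nra.
  by rewrite big_split/=; apply: lerD; [exact: sum_half_le|exact: vB].
move: cd; rewrite telescopeK => cd.
have -> : (fun n => u n x) = (fun n => (u n x - u 0 x) + u 0 x).
  by apply/funext => n; rewrite subrK.
by apply: is_cvgD => //; exact: is_cvg_cst.
Qed.

(** Fatou's lemma, applied to |u (m + n) - u n|^2 as m grows, transfers [fast_L2_dist] to the almost
    everywhere limit. *)
Lemma fast_L2_complete : exists f : H, forall n, L2_norm (f - u n) <= 2 * 2^-1 ^+ n.
Proof.
(* A function measurable on the whole space, which agrees with the limit wherever u n x
   converges. *)
pose f x := fine (limn_esup (fun n => (u n x)%:E)).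
have mf : measurable_fun setT f.
  apply: measurableT_comp => //; apply: measurable_fun_limn_esup => n.
  exact/measurable_EFinP.
have fcvg : {ae mu, forall x, u n x @[n --> \oo] --> f x}.
  apply: filterS fast_L2_cvg_ae => x cux.
  have /cvg_ex[l ul] := cux.
  have ulE : (u n x)%:E @[n --> \oo] --> l%:E by apply: cvg_EFin => //; exact: nearW.
  suff -> : f x = l by [].
  rewrite /f is_cvg_limn_esupE; first by rewrite (cvg_lim _ ulE).
  by apply/cvg_ex; exists l%:E.
have fB n : (\int[mu]_x ((f x - u n x) ^+ 2)%:E <= ((2 * 2^-1 ^+ n) ^+ 2)%:E)%E.
  pose w m (x : T) : \bar R := ((u (m + n)%N x - u n x) ^+ 2)%:E.
  have mw m : measurable_fun setT (w m).
    by apply/measurable_EFinP; apply: measurable_funX; exact: measurable_funB.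
  have w0 m x : (0 <= w m x)%E by rewrite lee_fin sqr_ge0.
  apply: (@le_trans _ _ (\int[mu]_x (limn_einf (w^~ x)))%E).
    apply: ae_ge0_le_integral => //.
    - by move=> x _; rewrite lee_fin sqr_ge0.
    - by apply/measurable_EFinP; apply: measurable_funX; exact: measurable_funB.
    - move=> x _; rewrite limn_einf_lim; apply: lime_ge; first exact: is_cvg_einfs.
      by apply: nearW => m; apply: le_ereal_inf_tmp => _ [k _ <-]; exact: w0.
    - rewrite (_ : (fun x => _) = (fun x => - limn_esup (fun m => - w m x)))%E.
        apply: measurableT_comp => //; apply: measurable_fun_limn_esup => m.
        exact: measurableT_comp.
      by apply/funext => x; rewrite (limn_esupN (w^~ x)) oppeK.
    - apply: filterS fcvg => x ux _.
      have wx : w m x @[m --> \oo] --> ((f x - u n x) ^+ 2)%:E.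
        apply: cvg_EFin; first exact: nearW.
        rewrite [X in X @ _ --> _](_ : _ = fun m => (u (m + n)%N x - u n x) ^+ 2)//.
        have h : (u (m + n)%N x - u n x) @[m --> \oo] --> f x - u n x.
          apply: cvgB; last exact: cvg_cst.
          by have := ux; rewrite -(cvg_shiftn n).
        by rewrite expr2; under eq_fun do rewrite expr2; exact: cvgM.
      by rewrite is_cvg_limn_einfE; [rewrite (cvg_lim _ wx)|apply/cvg_ex; eexists;
        exact: wx].
  apply: le_trans (fatou _ _ _ _) _ => //.
  apply: limn_einf_le => m.
  rewrite -(@EFin_L2_norm_sqr _ _ _ mu (u (m + n)%N - u n)) lee_fin.
  by rewrite ler_sqr ?nnegrE ?L2_norm_ge0 ?mulr_ge0 ?exprn_ge0// fast_L2_dist.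
(* The bound at n = 0 puts f - u 0 in L2; u 0 is then added back. *)
have gL : (f \- u 0) \in Lfun mu 2%:E.
  apply: mem_Lfun2; first exact: measurable_funB.
  by apply: le_lt_trans (fB 0%N) _; exact: ltry.
pose g : H := Lfun_Sub (lee1n 2) gL.
exists (g + u 0) => n.
rewrite -ler_sqr ?nnegrE ?L2_norm_ge0 ?mulr_ge0 ?exprn_ge0// -lee_fin EFin_L2_norm_sqr.
rewrite (eq_integral (fun x => ((f x - u n x) ^+ 2)%:E))// => x _.
by congr (_ ^+ 2)%:E; rewrite -[f x](subrK (u 0 x)).
Qed.

End L2_complete.

(** * Orthonormal bases *)

Section orthonormal_basis_theory.
Context d (T : measurableType d) (R : realType).
Variable mu : {measure set T -> \bar R}.
Local Notation H := (L2 mu).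
Variable e : nat -> H.
Hypothesis onb : orthonormal_basis e.
Implicit Types (f g : H) (a : nat -> R).

Let e_inner i j : L2_inner (e i) (e j) = (i == j)%:R.
Proof. by case: onb. Qed.

Lemma basis_comb_coord n a k :
  L2_inner (\sum_(i < n) a i *: e i) (e k) = if (k < n)%N then a k else 0.
Proof.
rewrite L2_inner_suml.
under eq_bigr do rewrite L2_innerZl e_inner.
case: ifPn => [kn|]; last first.
  rewrite -leqNgt => nk; rewrite big1// => i _.
  by rewrite ltn_eqF ?mulr0// (leq_trans (ltn_ord i)).
rewrite (bigD1 (Ordinal kn))//= eqxx mulr1 big1 ?addr0// => i ik.
by rewrite (_ : (_ == _) = false) ?mulr0//; apply/negbTE.
Qed.

Lemma basis_comb_inner n a f :
  L2_inner (\sum_(i < n) a i *: e i) f = \sum_(i < n) a i * L2_inner f (e i).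
Proof.
rewrite L2_inner_suml; apply: eq_bigr => i _.
by rewrite L2_innerZl (L2_innerC f).
Qed.

Lemma basis_comb_norm_sqr n a :
  L2_norm (\sum_(i < n) a i *: e i) ^+ 2 = \sum_(i < n) a i ^+ 2.
Proof.
rewrite L2_norm_sqrE basis_comb_inner; apply: eq_bigr => i _.
by rewrite basis_comb_coord ltn_ord expr2.
Qed.

(** Pythagoras: the residual of the projection is orthogonal to the span, and the last sum is the
    squared distance from the projection to the combination. It gives both Bessel's inequality and
    the optimality of the projection. *)
Lemma basis_dist_sqr n a f :
  L2_norm (f - \sum_(i < n) a i *: e i) ^+ 2 =
  L2_norm f ^+ 2 - \sum_(i < n) L2_inner f (e i) ^+ 2
  + \sum_(i < n) (L2_inner f (e i) - a i) ^+ 2.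
Proof.
rewrite [LHS]L2_norm_sqrE L2_innerBl !L2_innerBr -!L2_norm_sqrE basis_comb_norm_sqr.
rewrite (L2_innerC f) basis_comb_inner.
have -> : \sum_(i < n) (L2_inner f (e i) - a i) ^+ 2 =
    \sum_(i < n) L2_inner f (e i) ^+ 2 - 2 * \sum_(i < n) a i * L2_inner f (e i)
    + \sum_(i < n) a i ^+ 2.
  rewrite mulr_sumr -sumrB -big_split/=.
  by apply: eq_bigr => i _; ring.
ring.
Qed.

Lemma bessel n f : \sum_(i < n) L2_inner f (e i) ^+ 2 <= L2_norm f ^+ 2.
Proof.
have := sqr_ge0 (L2_norm (f - \sum_(i < n) L2_inner f (e i) *: e i)).
rewrite (basis_dist_sqr n (fun i => L2_inner f (e i))).
rewrite [X in _ + X]big1 ?addr0 ?subr_ge0// => i _.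
by rewrite subrr expr0n.
Qed.

(** Density yields one good combination, of length N. The projection of the same length is at least
    as close, and further coordinates only lower the residual, so every n >= N works. *)
Lemma cvg_basis_proj f :
  L2_norm (f - \sum_(i < n) L2_inner f (e i) *: e i) @[n --> \oo] --> (0 : R).
Proof.
apply/cvgrPdist_lt => eps eps0.
case: onb => _ /(_ f _ eps0)[N [a faN]].
exists N => // n /= Nn; rewrite sub0r normrN ger0_norm ?L2_norm_ge0//.
apply: le_lt_trans faN.
rewrite -ler_sqr ?nnegrE ?L2_norm_ge0// basis_dist_sqr (basis_dist_sqr n (fun i =>
  L2_inner f (e i))).
rewrite [X in _ + X <= _]big1 => [|i _]; last by rewrite subrr expr0n.
rewrite addr0 (@le_trans _ _ (L2_norm f ^+ 2 - \sum_(i < N) L2_inner f (e i) ^+ 2))//.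
  rewrite lerD2l lerN2 -(subnKC Nn) big_split_ord/= lerDl sumr_ge0// => i _.
  exact: sqr_ge0.
by rewrite lerDl sumr_ge0// => i _; exact: sqr_ge0.
Qed.

Lemma parseval_inner f g :
  \sum_(i < n) L2_inner f (e i) * L2_inner g (e i) @[n --> \oo] --> L2_inner f g.
Proof.
apply/cvgrPdist_le => eps eps0.
have e1 : 0 < eps / (L2_norm g + 1).
  by rewrite divr_gt0// (le_lt_trans (L2_norm_ge0 g))// ltrDl.
have /cvgrPdist_le /(_ _ e1) := cvg_basis_proj f.
apply: filterS => n; rewrite sub0r normrN ger0_norm ?L2_norm_ge0// => h.
rewrite -(basis_comb_inner n (fun i => L2_inner f (e i))) -L2_innerBl.
rewrite (le_trans (L2_cauchy_schwarz _ _))//.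
rewrite (le_trans (ler_wpM2r (L2_norm_ge0 g) h))//.
rewrite mulrAC ler_pdivrMr ?(le_lt_trans (L2_norm_ge0 g)) ?ltrDl//.
by rewrite ler_pM2l// lerDl.
Qed.

Lemma parseval f :
  (\sum_(0 <= k <oo) (L2_inner f (e k) ^+ 2)%:E = (L2_norm f ^+ 2)%:E)%E.
Proof.
apply: cvg_lim => //.
under eq_fun do rewrite sumEFin big_mkord.
apply: cvg_EFin; first exact: nearW.
rewrite L2_norm_sqrE; under eq_fun do under eq_bigr do rewrite expr2.
exact: parseval_inner.
Qed.

(** Squared distances between partial sums are bounded by tails of the series, so a subsequence
    satisfies the hypothesis of [fast_L2_complete]; continuity of the inner product then identifies
    the coordinates. *)
Lemma riesz_fischer a : (\sum_(0 <= k <oo) (a k ^+ 2)%:E < +oo)%E ->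
  exists f, forall k, L2_inner f (e k) = a k.
Proof.
move=> aoo.
have a0 k : (0 <= (a k ^+ 2)%:E)%E by rewrite lee_fin sqr_ge0.
have [N N_tail] : exists N : nat -> nat, forall j,
    (\sum_(N j <= k <oo) (a k ^+ 2)%:E <= ((2^-1 ^+ j.+1) ^+ 2)%:E)%E.
  suff h j : exists N, (\sum_(N <= k <oo) (a k ^+ 2)%:E <= ((2^-1 ^+ j.+1) ^+ 2)%:E)%E.
    by have [N ?] := choice h; exists N.
  have := @nneseries_tail_cvg _ (fun k => (a k ^+ 2)%:E) xpredT aoo (fun k _ => a0 k).
  have e0 : 0 < (2^-1 ^+ j.+1) ^+ 2 :> R by rewrite !exprn_gt0.
  move=> /fine_cvgP[fin_t]/cvgrPdist_le/(_ _ e0) near_t.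
  have [n _ nt] : \forall n \near \oo, (\sum_(n <= k <oo) (a k ^+ 2)%:E <= ((2^-1 ^+
    j.+1) ^+ 2)%:E)%E.
    near=> n.
    have fn : (\sum_(n <= k <oo) (a k ^+ 2)%:E \is a fin_num)%E by near: n.
    rewrite -(fineK fn) lee_fin.
    rewrite (le_trans (ler_norm _))// -normrN -sub0r.
    by near: n.
  by exists n; apply: nt => /=.
pose s n := \sum_(i < n) a i *: e i.
have s_tail n m : (n <= m)%N -> ((L2_norm (s m - s n) ^+ 2)%:E <= \sum_(n <= k <oo)
  (a k ^+ 2)%:E)%E.
  move=> /subnKC <-; move: (m - n)%N => k.
  rewrite /s basis_dist_sqr basis_comb_norm_sqr.
  rewrite -[X in (_ <= X)%E]nneseries_addn//.
  apply: le_trans (nneseries_ge k _); last by move=> ?; exact: a0.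
  rewrite sumEFin lee_fin [X in _ + X]big1 => [|i _]; last first.
    by rewrite basis_comb_coord ltn_addr// subrr expr0n.
  rewrite addr0 big_split_ord/= addrAC.
  under [X in _ - X + _]eq_bigr => i _ do rewrite basis_comb_coord ltn_addr//.
  by rewrite subrr add0r; under eq_bigr do rewrite addnC.
have s_close p q j : (N j <= p)%N -> (N j <= q)%N -> L2_norm (s p - s q) <= 2^-1 ^+
  j.+1.
  wlog qp : p q / (q <= p)%N => [th|] Np Nq.
    have [|/ltnW pq] := leqP q p; first by move=> ?; apply: th.
    by rewrite L2_normBC; apply: th.
  rewrite -ler_sqr ?nnegrE ?L2_norm_ge0 ?exprn_ge0// -lee_fin.
  apply: le_trans (s_tail _ _ qp) _; apply: le_trans (N_tail j).
  rewrite (nneseries_split (N j) (q - N j))//.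
  by rewrite subnKC// leeDr// sume_ge0.
(* Adding up all earlier ranks puts both M j and M (j + 1) beyond N j, and the summand j.+1 makes
   every index k eventually smaller than M j. *)
pose M j := (j.+1 + \sum_(i < j.+1) N i)%N.
pose u j := s (M j).
have leN j : (N j <= M j)%N by rewrite /M big_ord_recr/= addnA leq_addl.
have leNS j : (N j <= M j.+1)%N.
  apply: leq_trans (leN j) _; apply: leq_add => //.
  by rewrite [leqRHS]big_ord_recr leq_addr.
have u_fast j : L2_norm (u j.+1 - u j) <= 2^-1 ^+ j.
  apply: le_trans (s_close _ _ j _ _) _ => //.
  by rewrite exprS ler_piMl ?exprn_ge0//; lra.
have [f fu] := fast_L2_complete u_fast.
exists f => k; apply/eqP; rewrite -subr_eq0 -normr_le0; apply/ler_addgt0Pr => eps eps0.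
rewrite add0r.
have /cvgrPdist_le/(_ _ eps0)[n1 _ n1P] : 2 * 2^-1 ^+ n @[n --> \oo] --> (0 : R).
  by apply: cvg_geometric; rewrite ger0_norm; lra.
pose n := maxn n1 k.
have ue : L2_inner (u n) (e k) = a k.
  by rewrite /u /s basis_comb_coord ifT// /M ltn_addr// ltnS leq_maxr.
rewrite -ue -L2_innerBl (le_trans (L2_cauchy_schwarz _ _))//.
have -> : L2_norm (e k) = 1 by rewrite L2_norm_sqrt e_inner eqxx sqrtr1.
rewrite mulr1 (le_trans (fu n))//.
have := n1P n (leq_maxl _ _); rewrite sub0r normrN ger0_norm.
Unshelve. all: by end_near. Qed.

End orthonormal_basis_theory.

(** * Measurability in L2 *)

Section L2_measurable_theory.
Context d (T : measurableType d) (R : realType).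
Variable mu : {measure set T -> \bar R}.
Local Notation H := (L2 mu).
Context d' (Omega : measurableType d').
Implicit Types (f g : H) (X Y : Omega -> H).

(** The preimage of ]a, +oo[ under a Lipschitz function is [L2_open], and these half-lines generate
    the Borel sets. *)
Lemma measurable_L2_lipschitz (phi : H -> R) (K : R) X :
  (forall f g, `|phi f - phi g| <= K * L2_norm (f - g)) ->
  L2_measurable X -> measurable_fun setT (phi \o X).
Proof.
move=> phiK mX; apply: (measurability _ (RGenOInfty.measurableE R)) => //.
move=> _ [_ [a ->] <-]; rewrite setTI comp_preimage; apply: mX => f /=.
rewrite in_itv/= andbT => af.
have K0 : 0 < `|K| + 1 by rewrite ltr_wpDl.
exists ((phi f - a) / (`|K| + 1)); first by rewrite divr_gt0// subr_gt0.
move=> g; rewrite ltr_pdivlMr// => gf.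
rewrite in_itv/= andbT -subr_gt0.
have h : phi f - phi g < phi f - a.
  rewrite (le_lt_trans (ler_norm _))// (le_lt_trans (phiK _ _))// L2_normBC.
  rewrite (le_lt_trans _ gf)// mulrC ler_wpM2l ?L2_norm_ge0//.
  by rewrite (le_trans (ler_norm _))// lerDl.
by rewrite subr_gt0; move: h; rewrite ltrD2l ltrN2.
Qed.

Lemma measurable_L2_inner X g :
  L2_measurable X -> measurable_fun setT (fun w => L2_inner (X w) g).
Proof.
apply: (@measurable_L2_lipschitz (fun f => L2_inner f g) (L2_norm g)) => f h.
by rewrite -L2_innerBl mulrC L2_cauchy_schwarz.
Qed.

Variable e : nat -> H.
Hypothesis onb : orthonormal_basis e.

Lemma L2_norm_sqr_series f :
  L2_norm f ^+ 2 = fine (\sum_(0 <= k <oo) (L2_inner f (e k) ^+ 2)%:E)%E.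
Proof. by rewrite (parseval onb). Qed.

Lemma measurable_L2_norm_sqr X :
  (forall k, measurable_fun setT (fun w => L2_inner (X w) (e k))) ->
  measurable_fun setT (fun w => L2_norm (X w) ^+ 2).
Proof.
move=> mX; under eq_fun do rewrite L2_norm_sqr_series.
apply: measurableT_comp => //; apply: ge0_emeasurable_sum => k.
  by move=> w _ _; rewrite lee_fin sqr_ge0.
by move=> _; apply/measurable_EFinP; exact: measurable_funX.
Qed.

Lemma mean_square_norm_series (P : probability Omega R) X :
  (forall k, measurable_fun setT (fun w => L2_inner (X w) (e k))) ->
  (mean_square_norm P X =
   \sum_(0 <= k <oo) \int[P]_w (L2_inner (X w) (e k) ^+ 2)%:E)%E.
Proof.
move=> mX; rewrite /mean_square_norm unlock.
under eq_integral do rewrite -(parseval onb).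
rewrite integral_nneseries//.
  by move=> k; apply/measurable_EFinP; exact: measurable_funX.
by move=> k w _; rewrite lee_fin sqr_ge0.
Qed.

Let rational_comb (q : seq rat) : H := \sum_(i < size q) ratr q`_i *: e i.

Let rational_comb_dense f (eps : R) : 0 < eps ->
  exists q, L2_norm (f - rational_comb q) < eps.
Proof.
move=> eps0; have e2 : 0 < eps / 2 by rewrite divr_gt0.
have /cvgrPdist_lt/(_ _ e2)[n _ /(_ n (leqnn n))] := cvg_basis_proj onb f.
rewrite /= sub0r normrN ger0_norm ?L2_norm_ge0// => fn.
(* An error of this size in each of n coefficients costs at most eps / 2 in norm, because n <= (n +
   1)^2. *)
have dl : 0 < eps / 2 / n.+1%:R by rewrite divr_gt0.
have [q qP] : exists q : nat -> rat, forall i,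
    `|L2_inner f (e i) - ratr (q i)| < eps / 2 / n.+1%:R.
  suff h i : exists p : rat, `|L2_inner f (e i) - ratr p| < eps / 2 / n.+1%:R.
    by have [q ?] := choice h; exists q.
  have : L2_inner f (e i) < L2_inner f (e i) + eps / 2 / n.+1%:R by rewrite ltrDl.
  move=> /rat_in_itvoo[p]; rewrite in_itv/= => /andP[fp pf].
  by exists p; rewrite distrC ltr_distl pf andbT ltrBlDr (lt_trans fp)// ltrDl.
exists (mkseq q n); rewrite /rational_comb size_mkseq.
rewrite (eq_bigr (fun i : 'I_n => ratr (q i) *: e i)); last first.
  by move=> i _; rewrite nth_mkseq.
set S := \sum_(i < n) _ in fn; set S' := \sum_(i < n) _.
rewrite -(subrK S f) -addrA (le_lt_trans (ler_L2_normD _ _))//.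
rewrite [ltRHS]splitr; apply: ltr_leD; first exact: fn.
rewrite /S /S' -sumrB; under eq_bigr do rewrite -scalerBl.
rewrite -ler_sqr ?nnegrE ?L2_norm_ge0 ?(ltW e2)// (basis_comb_norm_sqr onb n (fun i
  => L2_inner f (e i) - ratr (q i))).
apply: (@le_trans _ _ (\sum_(i < n) (eps / 2 / n.+1%:R) ^+ 2)).
  by apply: ler_sum => i _; rewrite -real_normK ?num_real// ler_sqr ?nnegrE ?(ltW dl)
    ?(ltW (qP i)).
rewrite sumr_const card_ord -[leLHS]mulr_natl expr_div_n mulrCA ler_piMr ?sqr_ge0//.
rewrite ler_pdivrMr ?exprn_gt0// mul1r -natrX ler_nat.
by rewrite (@leq_trans n.+1)// leq_pmulr.
Qed.

(** Separability: an open set is the union of the balls that it contains among those centred at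
    rational combinations, with radius 1 / (m + 1). They are countably many, and preimages of balls
    are measurable by [measurable_L2_norm_sqr]. *)
Lemma L2_measurable_coord X :
  (forall k, measurable_fun setT (fun w => L2_inner (X w) (e k))) ->
  L2_measurable X.
Proof.
move=> mX U oU.
(* The second condition does not depend on w: [F p] is either the preimage of a ball or empty. *)
pose F (p : seq rat * nat) : set Omega :=
  [set w | L2_norm (X w - rational_comb p.1) < p.2.+1%:R^-1 /\
     forall g, L2_norm (g - rational_comb p.1) < p.2.+1%:R^-1 -> U g].
have -> : X @^-1` U = \bigcup_p F p.
  apply/seteqP; split => [w /= Uw|w [p _ [/= Xp]]]; last exact.
  have [r r0 rU] := oU _ Uw.
  have r2 : 0 < r / 2 by rewrite divr_gt0.
  have /cvgrPdist_lt/(_ _ r2)[m _ /(_ m (leqnn m))] := @cvg_harmonic R.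
  rewrite /= sub0r normrN ger0_norm// => mr.
  have m0 : 0 < m.+1%:R^-1 :> R by rewrite invr_gt0.
  have [q qX] := rational_comb_dense (X w) m0.
  exists (q, m) => //; split => //= g gq; apply: rU.
  rewrite -(subrK (rational_comb q) g) -addrA (le_lt_trans (ler_L2_normD _ _))//.
  rewrite (splitr r) ltrD// ?(lt_trans gq)//.
  by rewrite L2_normBC (lt_trans qX).
apply: countable_bigcupT_measurable => // p.
have [Up|nUp] := pselect (forall g, L2_norm (g - rational_comb p.1) < p.2.+1%:R^-1 ->
  U g).
  have -> : F p = (fun w => L2_norm (X w - rational_comb p.1) ^+ 2) @^-1` `]-oo,
    (p.2.+1%:R^-1) ^+ 2[.
    apply/seteqP; split => w /=; rewrite in_itv/= ltr_sqr ?nnegrE ?L2_norm_ge0//.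
    by case.
  rewrite -[X in measurable X]setTI; apply: measurable_L2_norm_sqr => // k.
  by under eq_fun do rewrite L2_innerBl; exact: measurable_funB.
by rewrite (_ : F p = set0)//; apply/seteqP; split => w // [].
Qed.

End L2_measurable_theory.

(** * The Ito isometry *)

Lemma cvg_sum_seq (R : realType) (I : Type) (r : seq I) (u : I -> nat -> R) (l : I ->
  R) :
  (forall i, u i n @[n --> \oo] --> l i) ->
  \sum_(i <- r) u i n @[n --> \oo] --> \sum_(i <- r) l i.
Proof.
move=> ul; elim: r => [|i r IH].
  by under eq_fun do rewrite big_nil; rewrite big_nil; exact: cvg_cst.
by under eq_fun do rewrite big_cons; rewrite big_cons; exact: cvgD.
Qed.

(** The definitions of the integrals state convergence for bare functions, in the extended reals.
    One finite term already puts u in L2, as (u - v N) + v N, and the convergence becomes one of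
    norms. *)
Lemma L2_of_approx d (T : measurableType d) (R : realType)
    (mu : {measure set T -> \bar R}) (u : T -> R) (v : nat -> L2 mu) :
  measurable_fun setT u ->
  (\int[mu]_x ((u x - v n x) ^+ 2)%:E)%E @[n --> \oo] --> 0%E ->
  exists2 U : L2 mu, U =1 u & L2_norm (U - v n) @[n --> \oo] --> (0 : R).
Proof.
move=> mu_ /fine_cvgP[[N _ fin] cvg0].
have uL : u \in Lfun mu 2%:E.
  have duv : (u \- v N) \in Lfun mu 2%:E.
    apply: mem_Lfun2; first exact: measurable_funB.
    have := fin N (leqnn N); rewrite ge0_fin_numE//.
    by apply: integral_ge0 => x _; rewrite lee_fin sqr_ge0.
  have -> : u = (u \- v N) \+ v N by apply/funext => x /=; rewrite subrK.
  have -> : (u \- v N) \+ v N = Lfun_Sub (lee1n 2) duv + v N :> (T -> R) by [].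
  exact: LfunP.
exists (Lfun_Sub (lee1n 2) uL) => //.
have := @cvg_comp _ _ _ _ _ _ _ _ cvg0 (@sqrt_continuous R 0).
rewrite sqrtr0; apply: cvg_trans; apply: near_eq_cvg; near=> n => /=.
rewrite -[RHS]ger0_norm ?L2_norm_ge0// -sqrtr_sqr; congr Num.sqrt.
by rewrite -[RHS]/(fine (_ ^+ 2)%:E) EFin_L2_norm_sqr.
Unshelve. all: by end_near. Qed.

Section itv_indicator.
Variable R : realType.
Local Notation leb := (@lebesgue_measure R).

Lemma integral_indic_itv (l r : R) :
  (\int[leb]_x (indic `]l, r]%classic x)%:E)%E = (if l < r then r - l else 0)%:E.
Proof.
rewrite integral_indic// setIT; apply: etrans (lebesgue_measure_itv _) _ => /=.
by rewrite lte_fin; case: ifP.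
Qed.

Lemma indic_itv_Lfun (l r : R) : (indic `]l, r]%classic : R -> R) \in Lfun leb 2%:E.
Proof.
apply: mem_Lfun2; first exact: measurable_indic.
rewrite (eq_integral (fun x : measurableTypeR R => (indic `]l, r]%classic x)%:E)); last first.
  by move=> x _; rewrite indicE; case: (_ \in _); rewrite ?expr1n ?expr0n.
by rewrite integral_indic_itv ltry.
Qed.

Definition itv_indic (l r : R) : L2 leb := Lfun_Sub (lee1n 2) (indic_itv_Lfun l r).

Lemma itv_indicE l r (x : R) : itv_indic l r x = ((l < x <= r)%R : bool)%:R.
Proof. by rewrite /itv_indic/= indicE mem_setE in_itv. Qed.

(** The length of the overlap of the two intervals, written as the covariance of the increments over
    them of a process with covariance min s t; this matches the expansion of [w_cov] in
    [wiener_isometry]. *)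
Lemma itv_indic_inner l r l' r' : l <= r -> l' <= r' ->
  L2_inner (itv_indic l r) (itv_indic l' r') =
  Num.min r r' - Num.min r l' - Num.min l r' + Num.min l l'.
Proof.
move=> lr lr'; apply/EFin_inj; rewrite EFin_L2_inner.
rewrite (eq_integral (fun x : measurableTypeR R =>
    (indic `]Num.max l l', Num.min r r']%classic x)%:E)); last first.
  move=> x _; rewrite !itv_indicE indicE mem_setE in_itv/= -natrM mulnb.
  by rewrite gt_max le_min; congr (GRing.natmul _ _)%:E; case: (l < x);
    case: (l' < x); case: (x <= r).
rewrite integral_indic_itv; congr EFin.
case: ifPn; rewrite -?leNgt;
  rewrite !minEle !maxEle; repeat case: ifPn; rewrite -?ltNge; lra.
Qed.

End itv_indicator.

Section wiener_isometry.
Context d (T : measurableType d) (R : realType).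
Variable mu : {measure set T -> \bar R}.
Local Notation H := (L2 mu).
Variable e : nat -> H.
Hypothesis onb : orthonormal_basis e.
Context dO (Omega : measurableType dO) (P : {measure set Omega -> \bar R}).
Variables (Q : H -> H) (w : R -> H -> L2 P) (lam : nat -> R).
Hypothesis Qe : forall k, Q (e k) = lam k *: e k %[ae mu].
Hypothesis w_cov : forall s t f g, 0 <= s -> 0 <= t ->
  L2_inner (w s f) (w t g) = Num.min s t * L2_inner (Q f) g.

Let leb := @lebesgue_measure R.

(* The symmetry of the covariance of W_Q makes Q symmetric. *)
Lemma wiener_Q_coord f k : L2_inner (Q f) (e k) = lam k * L2_inner f (e k).
Proof.
have := w_cov f (e k) ler01 ler01; have := w_cov (e k) f ler01 ler01.
rewrite minxx !mul1r L2_innerC => -> <-.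
by rewrite (eq_ae_L2_inner _ (Qe k)) L2_innerZl L2_innerC.
Qed.

Lemma cvg_wiener_Q f g :
  \sum_(j < n) lam j * (L2_inner f (e j) * L2_inner g (e j)) @[n --> \oo] -->
  L2_inner (Q f) g.
Proof.
have := @parseval_inner _ _ _ _ _ onb (Q f) g.
by under eq_fun do under eq_bigr do rewrite wiener_Q_coord -mulrA.
Qed.

(* ((l, r), (h, a)) stands for the increment a (W r h - W l h). *)
Definition wiener_sum (L : seq (R * R * (H * R))) : L2 P :=
  \sum_(p <- L) p.2.2 *: (w p.1.2 p.2.1 - w p.1.1 p.2.1).

(** The integrand against the coordinate <W, e_j> once each direction h is expanded in the basis. *)
Definition kernel_sum (L : seq (R * R * (H * R))) (j : nat) : L2 leb :=
  \sum_(p <- L) (p.2.2 * L2_inner p.2.1 (e j)) *: itv_indic p.1.1 p.1.2.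

(** Expanding both squares over pairs of entries produces the same overlap [ov p q], from four
    covariances of W on one side and from indicators of intervals on the other. The remaining factor
    <Q h, h'> is the limit given by [cvg_wiener_Q]. *)
Lemma wiener_isometry (L : seq (R * R * (H * R))) :
  (forall p, p \in L -> 0 <= p.1.1 <= p.1.2) ->
  \sum_(j < n) lam j * L2_norm (kernel_sum L j) ^+ 2 @[n --> \oo] -->
  L2_norm (wiener_sum L) ^+ 2.
Proof.
move=> L_ok.
pose ov (p q : R * R * (H * R)) : R :=
  Num.min p.1.2 q.1.2 - Num.min p.1.2 q.1.1 - Num.min p.1.1 q.1.2 + Num.min p.1.1 q.1.1.
have -> : L2_norm (wiener_sum L) ^+ 2 =
    \sum_(p <- L) \sum_(q <- L) p.2.2 * q.2.2 * ov p q * L2_inner (Q p.2.1) q.2.1.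
  rewrite L2_norm_sqrE L2_inner_suml big_seq [RHS]big_seq; apply: eq_bigr => p pL.
  rewrite L2_inner_sumr big_seq [RHS]big_seq; apply: eq_bigr => q qL.
  have /andP[p0 p1] := L_ok p pL; have /andP[q0 q1] := L_ok q qL.
  have p2 := le_trans p0 p1; have q2 := le_trans q0 q1.
  rewrite L2_innerZl L2_innerZr !(L2_innerBl, L2_innerBr) !w_cov// /ov.
  by ring.
have E n : \sum_(j < n) lam j * L2_norm (kernel_sum L j) ^+ 2 =
    \sum_(p <- L) \sum_(q <- L) p.2.2 * q.2.2 * ov p q *
      \sum_(j < n) lam j * (L2_inner p.2.1 (e j) * L2_inner q.2.1 (e j)).
  transitivity (\sum_(j < n) \sum_(p <- L) \sum_(q <- L) lam j *
     (p.2.2 * L2_inner p.2.1 (e j) * (q.2.2 * L2_inner q.2.1 (e j)) * ov p q)).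
    apply: eq_bigr => j _.
    rewrite L2_norm_sqrE L2_inner_suml mulr_sumr big_seq [RHS]big_seq;
      apply: eq_bigr => p pL.
    rewrite L2_inner_sumr mulr_sumr big_seq [RHS]big_seq; apply: eq_bigr => q qL.
    have /andP[p0 p1] := L_ok p pL; have /andP[q0 q1] := L_ok q qL.
    by rewrite L2_innerZl L2_innerZr itv_indic_inner// /ov; ring.
  rewrite exchange_big/=; apply: eq_bigr => p _.
  rewrite exchange_big/=; apply: eq_bigr => q _.
  by rewrite mulr_sumr; apply: eq_bigr => j _; ring.
under eq_fun do rewrite E.
apply: cvg_sum_seq => p; apply: cvg_sum_seq => q.
apply: cvgM; first exact: cvg_cst.
exact: cvg_wiener_Q.
Qed.

Lemma wiener_isometry_le (L : seq (R * R * (H * R))) (B : R) :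
  (forall p, p \in L -> 0 <= p.1.1 <= p.1.2) ->
  (forall n, \sum_(j < n) lam j * L2_norm (kernel_sum L j) ^+ 2 <= B) ->
  L2_norm (wiener_sum L) ^+ 2 <= B.
Proof.
move=> L_ok LB; have := wiener_isometry L_ok => /cvg_lim <-//.
by apply: limr_le; [apply/cvg_ex; eexists; exact: wiener_isometry|exact: nearW].
Qed.

End wiener_isometry.

(** The integral of a nonnegative function is a supremum over the simple functions below it, so no
    measurability is required. This serves for the Hilbert-Schmidt integrand, whose measurability in
    s is not established. *)
Lemma ge0_le_integral_lower d (T : measurableType d) (R : realType)
    (mu : {measure set T -> \bar R}) (D : set T) (f1 f2 : T -> \bar R) :
  (forall x, D x -> 0 <= f1 x)%E -> (forall x, D x -> f1 x <= f2 x)%E ->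
  (\int[mu]_(x in D) f1 x <= \int[mu]_(x in D) f2 x)%E.
Proof.
move=> f10 f12; rewrite !(integral_mkcond D).
have g0 x : (0 <= (f1 \_ D) x)%E by rewrite patchE; case: ifPn => // /set_mem;
  exact: f10.
have g12 x : ((f1 \_ D) x <= (f2 \_ D) x)%E.
  by rewrite !patchE; case: ifPn => // /set_mem; exact: f12.
rewrite !ge0_integralTE//; last by move=> x; exact: le_trans (g12 x).
apply: le_ereal_sup => _ [h /= hg <-]; exists h => //= x.
exact: le_trans (g12 x).
Qed.

Section L2_pointwise.
Context d (T : measurableType d) (R : realType).
Variable mu : {measure set T -> \bar R}.

Lemma L2_sumE (I : Type) (r : seq I) (P : pred I) (F : I -> L2 mu) x :
  (\sum_(i <- r | P i) F i) x = \sum_(i <- r | P i) F i x.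
Proof. by apply: (big_morph (fun f : L2 mu => f x)). Qed.

Lemma EFin_L2_norm_fun_sqr (f : L2 mu) (u : T -> R) : f =1 u ->
  (\int[mu]_x (u x ^+ 2)%:E = (L2_norm f ^+ 2)%:E)%E.
Proof. by move=> fu; rewrite EFin_L2_norm_sqr; apply: eq_integral => x _;
  rewrite fu. Qed.

Lemma cvg_L2_norm (u : nat -> L2 mu) (f : L2 mu) :
  L2_norm (f - u n) @[n --> \oo] --> (0 : R) ->
  L2_norm (u n) @[n --> \oo] --> L2_norm f.
Proof.
move=> uf; apply/cvgrPdist_le => eps eps0.
have /cvgrPdist_le/(_ _ eps0) := uf; apply: filterS => n.
rewrite sub0r normrN ger0_norm ?L2_norm_ge0//; apply: le_trans.
exact: ler_dist_L2_norm.
Qed.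

End L2_pointwise.

(** * Step functions and increments of W as elements of L2 *)

Section step_functions.
Variable R : realType.
Local Notation leb := (@lebesgue_measure R).

Definition step_L2 (phi : seq (R * R * R)) : L2 leb :=
  \sum_(p <- phi) p.2 *: itv_indic p.1.1 p.1.2.

Lemma step_L2E phi (s : R) : step_L2 phi s = step_eval phi s.
Proof.
rewrite /step_L2 L2_sumE /step_eval [RHS]big_mkcond/=; apply: eq_bigr => p _.
transitivity (p.2 * itv_indic p.1.1 p.1.2 s) => //.
by rewrite itv_indicE; case: ifP; rewrite ?mulr1 ?mulr0.
Qed.

(** Allows integrals over [0, t] to be treated as L2 norms on the whole line, with the kernel
    extended by 0. *)
Lemma step_L2_out phi (t s : R) :
  (forall p, p \in phi -> 0 <= p.1.1 <= p.1.2 /\ p.1.2 <= t) ->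
  ~ (0 <= s <= t) -> step_L2 phi s = 0.
Proof.
move=> phit st; rewrite step_L2E /step_eval big_seq_cond big1// => p
  /andP[/phit[/andP[p0 _] pt]].
move=> /andP[ps sp]; exfalso; apply: st.
by rewrite (le_trans p0 (ltW ps)) (le_trans sp pt).
Qed.

End step_functions.

Section wiener_increments.
Context d (T : measurableType d) (R : realType).
Variable mu : {measure set T -> \bar R}.
Local Notation H := (L2 mu).
Variable e : nat -> H.
Hypothesis onb : orthonormal_basis e.
Context dO (Omega : measurableType dO) (P : probability Omega R).
Variables (Q : H -> H) (W : R -> H -> Omega -> R) (lam : nat -> R).
Hypothesis Qe : forall k, Q (e k) = lam k *: e k %[ae mu].
Hypothesis HW : generalised_Q_wiener P Q W.
Hypothesis lam_gt0 : forall k, 0 < lam k.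
Local Notation leb := (@lebesgue_measure R).

(** Measurability is the one-term case of [wiener_gaussian]; the second moment is a covariance. *)
Lemma wiener_Lfun t f : 0 <= t -> W t f \in Lfun P 2%:E.
Proof.
move=> t0; apply: mem_Lfun2.
  have [|+ _] := wiener_gaussian HW (s := [:: (t, f)]).
    by move=> p; rewrite inE => /eqP ->.
  by under eq_fun do rewrite big_seq1.
have := wiener_covariance HW f f t0 t0; rewrite unlock => cov.
apply: le_lt_trans (ltry (Num.min t t * L2_inner (Q f) f)); rewrite -cov le_eqVlt.
by apply/orP; left; apply/eqP; apply: eq_integral => x _; rewrite expr2.
Qed.

(** Agreement with W holds at every point of Omega, so that sums of increments can be rewritten
    literally; at negative times the chosen element is 0. *)
Lemma wiener_L2 : exists w : R -> H -> L2 P,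
  (forall t f, 0 <= t -> w t f =1 W t f) /\
  (forall s t f g, 0 <= s -> 0 <= t ->
     L2_inner (w s f) (w t g) = Num.min s t * L2_inner (Q f) g).
Proof.
have /choice[w wE] : forall p : R * H, exists u : L2 P, 0 <= p.1 -> u =1 W p.1 p.2.
  move=> [t f] /=; have [t0|t0] := boolP (0 <= t).
    by exists (Lfun_Sub (lee1n 2) (wiener_Lfun f t0)).
  by exists 0.
exists (fun t f => w (t, f)); split; first by move=> t f; exact: (wE (t, f)).
move=> s t f g s0 t0; apply/EFin_inj; rewrite EFin_L2_inner.
rewrite -(wiener_covariance HW f g s0 t0) unlock; apply: eq_integral => x _.
by rewrite (wE (s, f))// (wE (t, g)).
Qed.

Variable w : R -> H -> L2 P.
Hypothesis wE : forall t f, 0 <= t -> w t f =1 W t f.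
Hypothesis w_cov : forall s t f g, 0 <= s -> 0 <= t ->
  L2_inner (w s f) (w t g) = Num.min s t * L2_inner (Q f) g.

Definition coord_increments (k : nat) (phi : seq (R * R * R)) : seq (R * R * (H * R)) :=
  [seq (p.1, (e k, p.2)) | p <- phi].

(** Pairing the rank-one integrand x |-> <h, x> g with e_k leaves the direction h with weight <g,
    e_k>, so each coordinate of an elementary integral is a [wiener_sum]. *)
Definition elementary_increments (k : nat) (Psi : seq (R * R * (H * H))) :
  seq (R * R * (H * R)) := [seq (p.1, (p.2.1, L2_inner p.2.2 (e k))) | p <- Psi].

Lemma kernel_coord k phi j :
  kernel_sum e (coord_increments k phi) j = (k == j)%:R *: step_L2 phi.
Proof.
rewrite /kernel_sum /coord_increments big_map /step_L2 scaler_sumr.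
by apply: eq_bigr => p _ /=; case: onb => -> _; rewrite scalerA mulrC.
Qed.

Lemma kernel_elementary k Psi j s :
  kernel_sum e (elementary_increments k Psi) j s =
  L2_inner (elementary_eval Psi s (e j)) (e k).
Proof.
rewrite /kernel_sum /elementary_increments big_map L2_sumE /elementary_eval.
rewrite L2_inner_suml [RHS]big_mkcond/=; apply: eq_bigr => p _.
transitivity (L2_inner p.2.2 (e k) * L2_inner p.2.1 (e j) * itv_indic p.1.1 p.1.2 s)
  => //.
by rewrite itv_indicE L2_innerZl; case: ifP; rewrite ?mulr1 ?mulr0// mulrC.
Qed.

Lemma wiener_sum_coord k phi x : (forall p, p \in phi -> 0 <= p.1.1 <= p.1.2) ->
  wiener_sum w (coord_increments k phi) x =
  Num.sqrt (lam k) * step_integral (coordinate_wiener W e lam k) phi x.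
Proof.
move=> phi0; rewrite /wiener_sum /coord_increments big_map L2_sumE.
rewrite /step_integral mulr_sumr big_seq [RHS]big_seq;
  apply: eq_bigr => p /phi0/andP[p0 p1].
transitivity (p.2 * (w p.1.2 (e k) x - w p.1.1 (e k) x)) => //.
rewrite !wE ?(le_trans p0 p1)// /coordinate_wiener -mulrBr mulrCA; congr (_ * _).
by rewrite mulrA mulfV ?mul1r// gt_eqF// sqrtr_gt0.
Qed.

Lemma wiener_sum_elementary k Psi x : (forall p, p \in Psi -> 0 <= p.1.1 <= p.1.2) ->
  wiener_sum w (elementary_increments k Psi) x =
  L2_inner (elementary_integral W Psi x) (e k).
Proof.
move=> Psi0; rewrite /wiener_sum /elementary_increments big_map L2_sumE.
rewrite /elementary_integral L2_inner_suml big_seq [RHS]big_seq.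
apply: eq_bigr => p /Psi0/andP[p0 p1].
transitivity (L2_inner p.2.2 (e k) * (w p.1.2 p.2.1 x - w p.1.1 p.2.1 x)) => //.
by rewrite !wE ?(le_trans p0 p1)// L2_innerZl mulrC.
Qed.

Lemma coord_isometry k phi : (forall p, p \in phi -> 0 <= p.1.1 <= p.1.2) ->
  L2_norm (wiener_sum w (coord_increments k phi)) ^+ 2 = lam k * L2_norm (step_L2
    phi) ^+ 2.
Proof.
move=> phi0.
have c : forall p, p \in coord_increments k phi -> 0 <= p.1.1 <= p.1.2.
  by move=> _ /mapP[q qphi ->]; exact: phi0.
have /cvg_lim <-// := wiener_isometry onb Qe w_cov c.
(* Only the kernel of index k is nonzero, so the partial sums are constant for n > k. *)
apply/lim_near_cst => //; exists k.+1 => // n /= kn.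
rewrite (bigD1 (Ordinal kn))//= kernel_coord eqxx scale1r big1 ?addr0// => i ik.
rewrite kernel_coord (_ : (_ == _) = false) ?scale0r ?L2_norm0 ?expr0n ?mulr0//.
by apply/negbTE; rewrite eq_sym.
Qed.

End wiener_increments.

(** * Coordinates of the stochastic integral *)

Lemma cvg_sqr_eq0 (R : realType) (u : nat -> R) :
  (forall n, 0 <= u n) -> u n ^+ 2 @[n --> \oo] --> 0 -> u n @[n --> \oo] --> 0.
Proof.
move=> u0 u2.
have := @cvg_comp _ _ _ _ _ _ _ _ u2 (@sqrt_continuous R 0).
rewrite sqrtr0; apply: cvg_trans; apply: near_eq_cvg; apply: nearW => n /=.
by rewrite sqrtr_sqr ger0_norm.
Qed.

Lemma sum_delta_le (R : realDomainType) (k n : nat) (u : nat -> R) :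
  0 <= u k -> \sum_(j < n) (k == j)%:R * u j <= u k.
Proof.
move=> uk; have [kn|nk] := ltnP k n.
  rewrite (bigD1 (Ordinal kn))//= eqxx mul1r big1 ?addr0// => i ik.
  by rewrite (_ : (_ == _) = false) ?mul0r//; apply/negbTE; rewrite eq_sym.
by rewrite big1// => i _; rewrite gtn_eqF ?mul0r// (leq_trans (ltn_ord i)).
Qed.

Section wiener_coordinates.
Context d (T : measurableType d) (R : realType).
Variable mu : {measure set T -> \bar R}.
Local Notation H := (L2 mu).
Variable e : nat -> H.
Hypothesis onb : orthonormal_basis e.
Context dO (Omega : measurableType dO) (P : probability Omega R).
Variables (Q : H -> H) (W : R -> H -> Omega -> R) (lam : nat -> R).
Hypothesis Qe : forall k, Q (e k) = lam k *: e k %[ae mu].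
Hypothesis lam_gt0 : forall k, 0 < lam k.
Local Notation leb := (@lebesgue_measure R).
Variable w : R -> H -> L2 P.
Hypothesis wE : forall t f, 0 <= t -> w t f =1 W t f.
Hypothesis w_cov : forall s t f g, 0 <= s -> 0 <= t ->
  L2_inner (w s f) (w t g) = Num.min s t * L2_inner (Q f) g.

Lemma basis_coord_sqr_le (f : H) k : L2_inner f (e k) ^+ 2 <= L2_norm f ^+ 2.
Proof.
apply: le_trans (bessel onb k.+1 f); rewrite big_ord_recr/= lerDr.
by apply: sumr_ge0 => i _; exact: sqr_ge0.
Qed.

(** The isometry passes to the limit: step functions and their integrals against the normalised
    process have equal norms, hence so do F and U. The factor sqrt(lam k) appears because
    [wiener_sum] uses W itself, not [coordinate_wiener]. *)
Lemma wiener_integral_L2 k t (f : R -> R) (I : Omega -> R) :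
  wiener_integral P (coordinate_wiener W e lam k) t f I ->
  exists (F : L2 leb) (U : L2 P) (phi : nat -> seq (R * R * R)),
  [/\ F =1 f \_ `[0, t], U =1 I,
      forall n p, p \in phi n -> 0 <= p.1.1 <= p.1.2 /\ p.1.2 <= t,
      L2_norm (F - step_L2 (phi n)) @[n --> \oo] --> (0 : R) &
      L2_norm (Num.sqrt (lam k) *: U - wiener_sum w (coord_increments e k (phi n)))
        @[n --> \oo] --> (0 : R) /\ L2_norm U = L2_norm F].
Proof.
move=> [mf mI [phi [phit f_phi I_phi]]].
have phi0 n p : p \in phi n -> 0 <= p.1.1 <= p.1.2 by move=> /phit[].
have slam : Num.sqrt (lam k) != 0 by rewrite gt_eqF// sqrtr_gt0.
have [||F FE Fphi] := @L2_of_approx _ _ R leb (f \_ `[0, t]) (fun n => step_L2 (phi n)).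
- by apply/(measurable_restrictT _ _).1.
- rewrite [X in X @ _ --> _](_ : _ = fun n => (\int[leb]_(s in `[0%R, t])
         ((f s - step_eval (phi n) s) ^+ 2)%:E)%E)//.
  apply/funext => n; rewrite [RHS]integral_mkcond; apply: eq_integral => s _.
  rewrite !patchE; case: ifPn => st; first by rewrite step_L2E.
  rewrite (step_L2_out (phit n)) ?subrr ?expr0n// => st'.
  by move/negP : st; apply; rewrite inE/= in_itv/=.
pose v n := (Num.sqrt (lam k))^-1 *: wiener_sum w (coord_increments e k (phi n)).
have [|U UE Uphi] := @L2_of_approx _ _ R P I v mI.
  move: I_phi; rewrite unlock.
  rewrite [X in X @ _ --> _ -> _](_ : _ = fun n => (\int[P]_x ((I x - v n x) ^+
    2)%:E)%E)//.
  apply/funext => n; apply: eq_integral => x _; congr ((_ - _) ^+ 2)%:E.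
  transitivity ((Num.sqrt (lam k))^-1 * wiener_sum w (coord_increments e k (phi n))
    x) => //.
  by rewrite (wiener_sum_coord e lam_gt0 wE k x (phi0 n)) mulrA mulVf// mul1r.
exists F, U, phi; split => //; split.
- rewrite [X in X @ _ --> _](_ : _ = fun n => Num.sqrt (lam k) * L2_norm (U - v n)).
    by rewrite -[X in _ --> X](mulr0 (Num.sqrt (lam k))); apply: cvgM => //;
      exact: cvg_cst.
  apply/funext => n; rewrite -[X in X * _]ger0_norm ?sqrtr_ge0// -L2_normZ.
  by rewrite scalerBr scalerA mulfV// scale1r.
- have lim1 := cvg_L2_norm Uphi; have lim2 := cvg_L2_norm Fphi.
  have /funext vE n : L2_norm (v n) = L2_norm (step_L2 (phi n)).
    apply/eqP; rewrite -(eqrXn2 (n := 2))// ?L2_norm_ge0//; apply/eqP.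
    rewrite /v L2_normZ exprMn (coord_isometry onb Qe w_cov k (phi0 n)).
    rewrite normfV exprVn real_normK ?num_real// sqr_sqrtr ?ltW// mulrA mulVf ?mul1r//.
    by rewrite gt_eqF.
  move: lim1; rewrite vE => lim1.
  by rewrite -(cvg_lim _ lim1)// -(cvg_lim _ lim2).
Qed.

Lemma wiener_sum_cat L1 L2 : wiener_sum w (L1 ++ L2) = wiener_sum w L1 + wiener_sum w
  L2.
Proof. exact: big_cat. Qed.

Variables (t : R) (Phi : R -> H -> H) (f : nat -> R -> R) (I : nat -> Omega -> R).
Hypothesis I_int : forall k,
  wiener_integral P (coordinate_wiener W e lam k) t (f k) (I k).
Hypothesis Phi_e : forall s k, 0 <= s <= t -> Phi s (e k) = f k s *: e k %[ae mu].

Lemma Phi_coord s j k g : 0 <= s <= t ->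
  L2_inner (Phi s (e j) - g) (e k) = (k == j)%:R * f k s - L2_inner g (e k).
Proof.
move=> st; rewrite L2_innerBl (eq_ae_L2_inner _ (Phi_e j st)) L2_innerZl.
case: onb => -> _; rewrite eq_sym; case: eqP => [->|_]; first by rewrite mulrC.
by rewrite mulr0 mul0r.
Qed.

Lemma elementary_eval_out (Psi : seq (R * R * (H * H))) (s : R) g :
  (forall p, p \in Psi -> 0 <= p.1.1 <= p.1.2 /\ p.1.2 <= t) ->
  ~ (0 <= s <= t) -> elementary_eval Psi s g = 0.
Proof.
move=> phit st; rewrite /elementary_eval big_seq_cond big1// => p
  /andP[/phit[/andP[p0 _] pt]].
move=> /andP[ps sp]; exfalso; apply: st.
by rewrite (le_trans p0 (ltW ps)) (le_trans sp pt).
Qed.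

(** One row of the matrix of Phi - Psi is controlled by the Hilbert-Schmidt norm: pointwise in s,
    the entry of row k in column j is at most the norm of column j, by Bessel. Since Phi is
    diagonal, F occurs only for j = k. *)
Lemma kernel_dist_le k (F : L2 leb) (Psi : seq (R * R * (H * H))) n :
  F =1 f k \_ `[0, t] ->
  (forall p, p \in Psi -> 0 <= p.1.1 <= p.1.2 /\ p.1.2 <= t) ->
  ((\sum_(j < n) lam j *
     L2_norm ((k == j)%:R *: F - kernel_sum e (elementary_increments e k Psi) j) ^+
       2)%:E <=
   \int[leb]_(s in `[0%R, t])
     hilbert_schmidt_sqr e lam (fun x => (Phi s x - elementary_eval Psi s x)%R))%E.
Proof.
move=> FE Psit.
pose G (j : nat) : L2 leb := (k == j)%:R *: F - kernel_sum e (elementary_increments e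
  k Psi) j.
have GE j (s : R) : G j s = (k == j)%:R * (f k \_ `[0, t]) s - L2_inner
  (elementary_eval Psi s (e j)) (e k).
  by rewrite -(kernel_elementary e) -FE.
have -> : (\sum_(j < n) lam j * L2_norm (G j) ^+ 2)%:E =
    (\int[leb]_s (\sum_(j < n) (lam j * G j s ^+ 2)%:E))%E.
  rewrite ge0_integral_sum//; last 2 first.
  - move=> j; apply/measurable_EFinP; apply: measurable_funM => //.
    exact: measurable_funX.
  - by move=> j s _; rewrite lee_fin mulr_ge0 ?sqr_ge0 ?ltW.
  rewrite -sumEFin; apply: eq_bigr => j _; rewrite EFinM EFin_L2_norm_sqr.
  rewrite -ge0_integralZl_EFin ?ltW//.
  - by move=> s _; rewrite lee_fin sqr_ge0.
  - by apply/measurable_EFinP; apply: measurable_funX.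
rewrite [leRHS]integral_mkcond; apply: ge0_le_integral_lower => s _.
  by apply: sume_ge0 => j _; rewrite lee_fin mulr_ge0 ?sqr_ge0 ?ltW.
rewrite patchE; case: ifPn => st; last first.
  have st' : ~ (0 <= s <= t).
    by move=> st'; move/negP : st; apply; rewrite inE/= in_itv/=.
  rewrite big1// => j _; rewrite GE elementary_eval_out// L2_inner0l subr0.
  by rewrite patchE (negbTE st) mulr0 expr0n mulr0.
have st' : 0 <= s <= t by move: st; rewrite inE/= in_itv/=.
apply: le_trans (nneseries_ge n _); last first.
  by move=> j; rewrite lee_fin mulr_ge0 ?sqr_ge0 ?ltW.
apply: lee_sum => j _; rewrite lee_fin; apply: ler_wpM2l; first exact: ltW.
rewrite GE.
apply: le_trans (basis_coord_sqr_le _ k).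
by rewrite Phi_coord// patchE st.
Qed.

(** Three-term comparison: <J, e_k> is close to the coordinate [v n] of an elementary integral,
    sqrt(lam k) I_k to the step integral [c n], and [v n - c n] is small because both integrands
    approximate the same row of Phi. *)
Lemma stochastic_integral_coord J : stochastic_integral P e lam W t Phi J ->
  forall k, L2_measurable J /\
  (fun x => L2_inner (J x) (e k)) = (fun x => Num.sqrt (lam k) * I k x) %[ae P].
Proof.
move=> [_ mJ [Psi [Psit HS0 MS0]]] k; split => //.
have [F [U [phi [FE UE phit Fphi [Uphi _]]]]] := wiener_integral_L2 (I_int k).
have Psi0 n p : p \in Psi n -> 0 <= p.1.1 <= p.1.2 by move=> /Psit[].
have phi0 n p : p \in phi n -> 0 <= p.1.1 <= p.1.2 by move=> /phit[].
pose v n := wiener_sum w (elementary_increments e k (Psi n)).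
have [||V VE Vv] := @L2_of_approx _ _ R P (fun x => L2_inner (J x) (e k)) v.
- exact: measurable_L2_inner.
- apply: (squeeze_cvge _ (cvg_cst _) MS0); apply: nearW => n.
  apply/andP; split; first by apply: integral_ge0 => x _; rewrite lee_fin sqr_ge0.
  rewrite /mean_square_norm unlock; apply: ge0_le_integral_lower => x _.
    by rewrite lee_fin sqr_ge0.
  rewrite /v (wiener_sum_elementary e wE k x (Psi0 n)) -L2_innerBl lee_fin.
  exact: basis_coord_sqr_le.
pose c n := wiener_sum w (coord_increments e k (phi n)).
pose HS n := (\int[leb]_(s in `[0%R, t])
     hilbert_schmidt_sqr e lam (fun x => (Phi s x - elementary_eval (Psi n) s x)%R))%E.
have key n : HS n \is a fin_num ->
    L2_norm (v n - c n) ^+ 2 <= 2 * fine (HS n) + 2 * (lam k * L2_norm (F - step_L2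
      (phi n)) ^+ 2).
  move=> fin.
  (* Negating the weights of [phi n] turns the difference into the sum over a single list, to which
     the isometry applies. *)
  pose L := elementary_increments e k (Psi n) ++ coord_increments e k [seq (p.1, -
    p.2) | p <- phi n].
  have -> : v n - c n = wiener_sum w L.
    rewrite wiener_sum_cat; congr (_ + _); rewrite /c /wiener_sum /coord_increments.
    by rewrite !big_map -sumrN; apply: eq_bigr => p _; rewrite scaleNr.
  apply: (wiener_isometry_le onb Qe w_cov).
    move=> p; rewrite mem_cat => /orP[|] /mapP[q].
      by move=> qP ->; exact: (Psi0 n _ qP).
    by move=> /mapP[q' q'P ->] ->; exact: (phi0 n _ q'P).
  move=> N.
  (* The exact row of Phi, F at j = k, is inserted between the two approximations. *)
  have KE j : kernel_sum e L j = (k == j)%:R *: (F - step_L2 (phi n))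
      - ((k == j)%:R *: F - kernel_sum e (elementary_increments e k (Psi n)) j).
    have -> : kernel_sum e L j = kernel_sum e (elementary_increments e k (Psi n)) j
        + kernel_sum e (coord_increments e k [seq (p.1, - p.2) | p <- phi n]) j.
      exact: big_cat.
    rewrite kernel_coord// (_ : step_L2 _ = - step_L2 (phi n)); last first.
      by rewrite /step_L2 big_map -sumrN; apply: eq_bigr => p _; rewrite scaleNr.
    by rewrite scalerBr opprB scalerN [RHS]addrC subrKA.
  apply: (@le_trans _ _ (\sum_(j < N) (2 * (lam j *
     L2_norm ((k == j)%:R *: F - kernel_sum e (elementary_increments e k (Psi n)) j)
       ^+ 2)
     + 2 * ((k == j)%:R * (lam j * L2_norm (F - step_L2 (phi n)) ^+ 2))))).
    apply: ler_sum => j _; rewrite KE.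
    apply: le_trans (ler_wpM2l (ltW (lam_gt0 j)) (L2_normDsqr _ _)) _.
    rewrite L2_normN L2_normZ le_eqVlt; apply/orP; left; apply/eqP.
    by rewrite normr_nat; case: (k == j); rewrite /= ?mulr1n ?mulr0n; ring.
  rewrite big_split/= -!mulr_sumr; apply: lerD.
    rewrite ler_pM2l// -lee_fin fineK//; exact: (kernel_dist_le _ FE (Psit n)).
  rewrite ler_pM2l//; apply: (sum_delta_le N (u := fun j => lam j * L2_norm (F -
    step_L2 (phi n)) ^+ 2)).
  by rewrite mulr_ge0 ?sqr_ge0 ?ltW.
have vc : L2_norm (v n - c n) @[n --> \oo] --> (0 : R).
  apply: cvg_sqr_eq0 => [n|]; first exact: L2_norm_ge0.
  have /fine_cvgP[fin HS0'] := HS0.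
  have lim0 : 2 * fine (HS n) + 2 * (lam k * L2_norm (F - step_L2 (phi n)) ^+ 2) @[n
    --> \oo] --> (0 : R).
    rewrite -[X in _ --> X](addr0 (0 : R)).
    rewrite -[X in _ --> X + _](mulr0 2) -[X in _ --> _ + X](mulr0 2).
    apply: cvgD; first by apply: cvgM; [exact: cvg_cst|exact: HS0'].
    apply: cvgM; first exact: cvg_cst.
    rewrite -[X in _ --> X](mulr0 (lam k)); apply: cvgM; first exact: cvg_cst.
    rewrite -[X in _ --> X](mulr0 (0 : R)).
    by under eq_fun do rewrite expr2; exact: cvgM.
  apply: (squeeze_cvgr _ (cvg_cst _) lim0).
  by apply: filterS fin => n finn; rewrite sqr_ge0 key.
have : L2_norm (V - Num.sqrt (lam k) *: U) = 0.
  apply/eqP; rewrite eq_le L2_norm_ge0 andbT.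
  have lim3 : L2_norm (V - v n) + L2_norm (v n - c n)
      + L2_norm (Num.sqrt (lam k) *: U - c n) @[n --> \oo] --> (0 : R).
    rewrite -[X in _ --> X](addr0 (0 : R)); apply: cvgD => //.
    by rewrite -[X in _ --> X](addr0 (0 : R)); apply: cvgD.
  rewrite -(cvg_lim _ lim3)//; apply: limr_ge; first by apply/cvg_ex; exists 0.
  apply: nearW => n; rewrite [X in _ <= _ + X]L2_normBC.
  apply: le_trans (lerD (ler_L2_normD _ _) (lexx _)).
  apply: le_trans (ler_L2_normD _ _).
  by rewrite !subrKA.
move=> /L2_norm_eq0; apply: filterS => x /(_ Logic.I) h _.
rewrite -VE -UE; apply/eqP; rewrite -subr_eq0; apply/eqP; exact: h.
Qed.

End wiener_coordinates.

(** * Existence of the stochastic integral *)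

(** The first n terms add up to at most 2 / (n + 1), and the others form a tail of a convergent
    series. This governs both the Hilbert-Schmidt error of the elementary integrands and the mean
    square error of their integrals. *)
Lemma cvg_split_series (R : realType) (x : nat -> nat -> R) (y : nat -> R) :
  (forall n k, 0 <= x n k) ->
  (forall n k, (k < n)%N -> x n k <= 2^-1 ^+ k / n.+1%:R) ->
  (forall n k, (n <= k)%N -> x n k = y k) ->
  (\sum_(0 <= k <oo) (y k)%:E < +oo)%E ->
  (\sum_(0 <= k <oo) (x n k)%:E)%E @[n --> \oo] --> 0%E.
Proof.
move=> x0 x_lt x_ge yoo.
have y0 k : 0 <= y k by rewrite -(x_ge k k).
have xE n k : (0 <= (x n k)%:E)%E by rewrite lee_fin.
have tail0 := @nneseries_tail_cvg _ (fun k => (y k)%:E) xpredT yoo (fun k _ => y0 k).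
have bound0 : ((2 / n.+1%:R)%:E + \sum_(n <= k <oo) (y k)%:E)%E @[n --> \oo] --> 0%E.
  rewrite -[X in _ --> X](adde0 0%E); apply: cvgeD => //.
  apply: cvg_EFin; first exact: nearW.
  rewrite -[X in _ --> X](mulr0 (2 : R)); apply: cvgM; first exact: cvg_cst.
  exact: cvg_harmonic.
apply: (squeeze_cvge _ (cvg_cst _) bound0); apply: nearW => n.
rewrite nneseries_ge0//= (nneseries_split 0 n)//; apply: leeD.
  rewrite add0n big_mkord sumEFin lee_fin.
  apply: (@le_trans _ _ (\sum_(k < n) 2^-1 ^+ k / n.+1%:R)).
    by apply: ler_sum => k _; exact: x_lt.
  by rewrite -mulr_suml ler_wpM2r// sum_half_le.
rewrite add0n eseries_cond [leRHS]eseries_cond.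
apply: lee_nneseries => [k _ _|k /andP[_ nk]]; first exact: xE.
by rewrite x_ge.
Qed.

Section stochastic_integral_existence.
Context d (T : measurableType d) (R : realType).
Variable mu : {measure set T -> \bar R}.
Local Notation H := (L2 mu).
Variable e : nat -> H.
Hypothesis onb : orthonormal_basis e.
Context dO (Omega : measurableType dO) (P : probability Omega R).
Variables (Q : H -> H) (W : R -> H -> Omega -> R) (lam : nat -> R).
Hypothesis Qe : forall k, Q (e k) = lam k *: e k %[ae mu].
Hypothesis lam_gt0 : forall k, 0 < lam k.
Local Notation leb := (@lebesgue_measure R).
Variable w : R -> H -> L2 P.
Hypothesis wE : forall t f, 0 <= t -> w t f =1 W t f.
Hypothesis w_cov : forall s t f g, 0 <= s -> 0 <= t ->
  L2_inner (w s f) (w t g) = Num.min s t * L2_inner (Q f) g.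
Variables (t : R) (Phi : R -> H -> H) (f : nat -> R -> R) (I : nat -> Omega -> R).
Hypothesis I_int : forall k,
  wiener_integral P (coordinate_wiener W e lam k) t (f k) (I k).
Hypothesis Phi_e : forall s k, 0 <= s <= t -> Phi s (e k) = f k s *: e k %[ae mu].
Hypothesis f_sum : (\sum_(0 <= k <oo)
  ((lam k)%:E * \int[leb]_(s in `[0%R, t]) (f k s ^+ 2)%:E) < +oo)%E.

(** The finite-rank integrand sum_(k < n) psi_k(s) <e_k, .> e_k, diagonal like Phi. *)
Definition diagonal_steps (psi : nat -> seq (R * R * R)) (n : nat) :
    seq (R * R * (H * H)) :=
  flatten [seq [seq (p.1, (e k, p.2 *: e k)) | p <- psi k] | k <- index_iota 0 n].

Lemma diagonal_steps_eval psi n s g :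
  elementary_eval (diagonal_steps psi n) s g =
  \sum_(k < n) (L2_inner (e k) g * step_L2 (psi k) s) *: e k.
Proof.
rewrite /elementary_eval big_flatten/= big_map big_mkord; apply: eq_bigr => k _.
rewrite big_map step_L2E /step_eval mulr_sumr scaler_suml; apply: eq_bigr => p _ /=.
by rewrite scalerA.
Qed.

Lemma diagonal_steps_integral psi n x :
  (forall k p, p \in psi k -> 0 <= p.1.1 <= p.1.2) ->
  elementary_integral W (diagonal_steps psi n) x =
  \sum_(k < n) wiener_sum w (coord_increments e k (psi k)) x *: e k.
Proof.
move=> psi0; rewrite /elementary_integral big_flatten/= big_map big_mkord.
apply: eq_bigr => k _; rewrite big_map /= /wiener_sum /coord_increments big_map L2_sumE.
rewrite scaler_suml big_seq [RHS]big_seq; apply: eq_bigr => p /psi0/andP[p0 p1] /=.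
rewrite scalerA; congr (_ *: _).
transitivity (p.2 * (w p.1.2 (e k) x - w p.1.1 (e k) x)) => //.
by rewrite !wE ?(le_trans p0 p1)// mulrC.
Qed.

Lemma diagonal_steps_mem psi n p :
  (forall k p, p \in psi k -> 0 <= p.1.1 <= p.1.2 /\ p.1.2 <= t) ->
  p \in diagonal_steps psi n -> 0 <= p.1.1 <= p.1.2 /\ p.1.2 <= t.
Proof.
by move=> psit /flattenP[_ /mapP[k _ ->]] /mapP[q qk ->]; exact: (psit k).
Qed.

(** In both convergences the error splits over k: small by choice of the steps for k < n, and equal
    to lam k |F k|^2, summable by [f_sum], for k >= n. *)
Lemma exists_stochastic_integral : exists J, stochastic_integral P e lam W t Phi J.
Proof.
have /choice[z zP] : forall k, exists z : L2 leb * L2 P * (nat -> seq (R * R * R)),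
    [/\ z.1.1 =1 f k \_ `[0, t], z.1.2 =1 I k,
      forall n p, p \in z.2 n -> 0 <= p.1.1 <= p.1.2 /\ p.1.2 <= t,
      L2_norm (z.1.1 - step_L2 (z.2 n)) @[n --> \oo] --> (0 : R) &
      L2_norm (Num.sqrt (lam k) *: z.1.2 - wiener_sum w (coord_increments e k (z.2 n)))
        @[n --> \oo] --> (0 : R) /\ L2_norm z.1.2 = L2_norm z.1.1].
  move=> k; have [F [U [phi FUphi]]] := wiener_integral_L2 onb Qe lam_gt0 wE w_cov
    (I_int k).
  by exists (F, U, phi).
pose F k := (z k).1.1; pose U k := (z k).1.2.
have FE k : F k =1 f k \_ `[0, t] by case: (zP k).
have FU k : L2_norm (U k) = L2_norm (F k) by case: (zP k) => _ _ _ _ [].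
have Foo : (\sum_(0 <= k <oo) (lam k * L2_norm (F k) ^+ 2)%:E < +oo)%E.
  apply: le_lt_trans f_sum; apply: lee_nneseries => [k _ _|k _].
    by rewrite lee_fin mulr_ge0 ?sqr_ge0 ?ltW.
  rewrite EFinM EFin_L2_norm_sqr [X in (_ <= _ * X)%E]integral_mkcond.
  rewrite le_eqVlt; apply/orP; left; apply/eqP; congr (_ * _)%E.
  by apply: eq_integral => s _; rewrite FE !patchE; case: ifP; rewrite ?expr0n.
(* The error 2^-k / (n + 1) is summable in k and vanishes in n. The same step function has to serve
   the kernel and its integral. *)
have /choice[psi psiP] : forall nk : nat * nat, exists psi : seq (R * R * R),
    [/\ forall p, p \in psi -> 0 <= p.1.1 <= p.1.2 /\ p.1.2 <= t,
      lam nk.2 * L2_norm (F nk.2 - step_L2 psi) ^+ 2 <= 2^-1 ^+ nk.2 / nk.1.+1%:R &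
      L2_norm (Num.sqrt (lam nk.2) *: U nk.2 - wiener_sum w (coord_increments e nk.2
        psi)) ^+ 2
        <= 2^-1 ^+ nk.2 / nk.1.+1%:R].
  move=> [n k] /=; have [_ _ phit cF [cU _]] := zP k.
  have eps0 : 0 < 2^-1 ^+ k / n.+1%:R :> R by rewrite divr_gt0// exprn_gt0.
  have cF2 : lam k * L2_norm (F k - step_L2 ((z k).2 m)) ^+ 2 @[m --> \oo] --> (0 : R).
    rewrite -[X in _ --> X](mulr0 (lam k)); apply: cvgM; first exact: cvg_cst.
    rewrite -[X in _ --> X](mulr0 (0 : R)).
    by under eq_fun do rewrite expr2; exact: cvgM.
  have cU2 : L2_norm (Num.sqrt (lam k) *: U k - wiener_sum w (coord_increments e k
    ((z k).2 m))) ^+ 2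
      @[m --> \oo] --> (0 : R).
    rewrite -[X in _ --> X](mulr0 (0 : R)).
    by under eq_fun do rewrite expr2; exact: cvgM.
  have [m [mF mU]] : exists m, lam k * L2_norm (F k - step_L2 ((z k).2 m)) ^+ 2 <=
    2^-1 ^+ k / n.+1%:R /\
      L2_norm (Num.sqrt (lam k) *: U k - wiener_sum w (coord_increments e k ((z k).2
        m))) ^+ 2
        <= 2^-1 ^+ k / n.+1%:R.
    move/cvgrPdist_le : cF2 => /(_ _ eps0)[m1 _ h1].
    move/cvgrPdist_le : cU2 => /(_ _ eps0)[m2 _ h2].
    exists (maxn m1 m2); split.
      have := h1 _ (leq_maxl m1 m2); rewrite sub0r normrN; apply: le_trans;
        exact: ler_norm.
    have := h2 _ (leq_maxr m1 m2); rewrite sub0r normrN; apply: le_trans;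
      exact: ler_norm.
  by exists ((z k).2 m); split => //; exact: phit.
pose Psi n := diagonal_steps (fun k => psi (n, k)) n.
have psit n k p : p \in psi (n, k) -> 0 <= p.1.1 <= p.1.2 /\ p.1.2 <= t.
  by move=> pp; have [/(_ _ pp)] := psiP (n, k).
have psi0 n k p : p \in psi (n, k) -> 0 <= p.1.1 <= p.1.2 by move=> /psit[].
(* Riesz-Fischer is applied at every point of Omega, so the coordinates are set
   to 0 off the almost sure set G where they are square-summable. *)
pose a k x := Num.sqrt (lam k) * U k x.
have ma k : measurable_fun setT (a k) by apply: measurable_funM.
pose S x : \bar R := (\sum_(0 <= k <oo) (a k x ^+ 2)%:E)%E.
have mS : measurable_fun setT S.
  apply: ge0_emeasurable_sum => k; first by move=> x _ _; rewrite lee_fin sqr_ge0.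
  by move=> _; apply/measurable_EFinP; exact: measurable_funX.
have aL2 k : (\int[P]_x (a k x ^+ 2)%:E = (lam k * L2_norm (F k) ^+ 2)%:E)%E.
  rewrite (EFin_L2_norm_fun_sqr (f := Num.sqrt (lam k) *: U k))// L2_normZ exprMn FU.
  by rewrite real_normK ?num_real// sqr_sqrtr// ltW.
have S_ae : {ae P, forall x, (S x < +oo)%E}.
  have iS : P.-integrable setT S.
    apply/integrableP; split => //.
    rewrite (eq_integral S); last first.
      by move=> x _; rewrite gee0_abs// nneseries_ge0// => k _ _;
        rewrite lee_fin sqr_ge0.
    rewrite /S integral_nneseries//.
    - apply: le_lt_trans Foo; apply: lee_nneseries => [k _ _|k _]; last by rewrite aL2.
      by apply: integral_ge0 => x _; rewrite lee_fin sqr_ge0.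
    - by move=> k; apply/measurable_EFinP; exact: measurable_funX.
    - by move=> k x _; rewrite lee_fin sqr_ge0.
  by have := integrable_ae measurableT iS; apply: filterS => x /(_ Logic.I);
    rewrite fin_numElt => /andP[].
pose G : set Omega := S @^-1` [set` `]-oo%E, +oo%E[].
have GE x : (x \in G) = (S x < +oo)%E.
  apply/idP/idP; rewrite inE /G/= in_itv/=.
    by move=> /andP[].
  move=> ->; rewrite andbT (lt_le_trans ltNy0)//.
  by apply: nneseries_ge0 => k _ _; rewrite lee_fin sqr_ge0.
have mG : measurable G by rewrite /G -[X in measurable X]setTI; apply: mS => //;
  exact: emeasurable_itv.
pose a' k x := if x \in G then a k x else 0.
have ma' k : measurable_fun setT (a' k).
  rewrite (_ : a' k = a k \_ G); last by apply/funext => x; rewrite /a' patchE.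
  by apply/(measurable_restrictT _ mG).1; exact: measurable_funTS (ma k).
have /choice[J JE] : forall x, exists g : H, forall k, L2_inner g (e k) = a' k x.
  move=> x; apply: (riesz_fischer onb (a := a' ^~ x)).
  have [xG|xG] := boolP (x \in G).
    by under eq_eseriesr do rewrite /a' xG; rewrite -GE.
  by rewrite eseries0 ?ltry// => k _ _; rewrite /a' (negbTE xG) expr0n.
have a'_ae k : {ae P, forall x, a' k x = a k x}.
  by apply: filterS S_ae => x Sx; rewrite /a' GE Sx.
exists J; split.
- move=> k g; apply: (eq_measurable_fun (fun s => f k s * L2_inner (e k) g)).
    move=> s; rewrite inE/= in_itv/= => st.
    by rewrite (eq_ae_L2_inner _ (Phi_e k st)) L2_innerZl.
  by apply: measurable_funM => //; case: (I_int k).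
- apply: (L2_measurable_coord onb) => k.
  by rewrite (_ : (fun _ => _) = a' k)//; apply/funext => x; exact: JE.
exists Psi; split.
- by move=> n p; apply: diagonal_steps_mem; exact: psit.
(* Both operators are diagonal in e: [D n k] is the k-th entry of their difference. *)
- pose D n k : L2 leb := F k - (k < n)%N%:R *: step_L2 (psi (n, k)).
  have -> : (fun n => \int[leb]_(s in `[0%R, t])
      hilbert_schmidt_sqr e lam (fun x => Phi s x - elementary_eval (Psi n) s x)%R)%E =
      (fun n => \sum_(0 <= k <oo) (lam k * L2_norm (D n k) ^+ 2)%:E)%E.
    apply/funext => n; rewrite integral_mkcond.
    rewrite (eq_integral (fun s => \sum_(0 <= k <oo) (lam k * D n k s ^+ 2)%:E)%E).
      rewrite integral_nneseries//.
      - apply: eq_eseriesr => k _.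
        rewrite EFinM EFin_L2_norm_sqr -ge0_integralZl_EFin ?ltW//.
        + by move=> s _; rewrite lee_fin sqr_ge0.
        + by apply/measurable_EFinP; apply: measurable_funX.
      - move=> k; apply/measurable_EFinP; apply: measurable_funM => //;
        exact: measurable_funX.
      - by move=> k s _; rewrite lee_fin mulr_ge0 ?sqr_ge0 ?ltW.
    move=> s _.
    have DE k : D n k s = (f k \_ `[0, t]) s - (k < n)%N%:R * step_L2 (psi (n, k)) s.
      by rewrite -FE.
    rewrite patchE; case: ifPn => st; last first.
      have st' : ~ (0 <= s <= t).
        by move=> st'; move/negP : st; apply; rewrite inE/= in_itv/=.
      rewrite eseries0// => k _ _;
        rewrite DE patchE (negbTE st) (step_L2_out (psit n k))//.
      by rewrite mulr0 subrr expr0n mulr0.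
    have st' : 0 <= s <= t by move: st; rewrite inE/= in_itv/=.
    apply: eq_eseriesr => k _; congr (_ * _)%:E.
    rewrite diagonal_steps_eval.
    transitivity (L2_norm (D n k s *: e k) ^+ 2).
      congr (_ ^+ 2); apply: eq_ae_L2_norm.
      have -> : \sum_(i < n) (L2_inner (e i) (e k) * step_L2 (psi (n, i : nat)) s) *:
        e i =
          ((k < n)%N%:R * step_L2 (psi (n, k)) s) *: e k.
        have ee i : L2_inner (e i) (e k) = (i == k)%:R by case: onb.
        under eq_bigr do rewrite ee; have [kn|nk] := ltnP k n.
          rewrite (bigD1 (Ordinal kn))//= eqxx big1 ?addr0// => i ik.
          by rewrite (_ : (_ == _) = false) ?mul0r ?scale0r//; apply/negbTE.
        rewrite mul0r scale0r big1// => i _.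
        by rewrite ltn_eqF ?mul0r ?scale0r// (leq_trans (ltn_ord i)).
      apply: filterS (Phi_e k st') => x /(_ Logic.I) h _.
      rewrite DE patchE st scalerBl.
      transitivity (Phi s (e k) x - ((k < n)%N%:R * step_L2 (psi (n, k)) s *: e k) x)
        => //.
      by rewrite h.
    rewrite L2_normZ L2_norm_sqrt; case: onb => -> _.
    by rewrite eqxx sqrtr1 mulr1 real_normK ?num_real.
  apply: (cvg_split_series (y := fun k => lam k * L2_norm (F k) ^+ 2)) => //.
  + by move=> n k; rewrite mulr_ge0 ?sqr_ge0 ?ltW.
  + by move=> n k kn; rewrite /D kn scale1r; have [] := psiP (n, k).
  + by move=> n k nk; rewrite /D ltnNge nk/= scale0r subr0.
(* The k-th coordinate of J minus the elementary integral, up to the null set where [a'] differs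
   from [a]. *)
- pose D n k : L2 P := Num.sqrt (lam k) *: U k
    - (k < n)%N%:R *: wiener_sum w (coord_increments e k (psi (n, k))).
  have JD n k x : L2_inner (J x - elementary_integral W (Psi n) x) (e k) =
      a' k x - (k < n)%N%:R * wiener_sum w (coord_increments e k (psi (n, k))) x.
    rewrite L2_innerBl JE diagonal_steps_integral; last exact: psi0.
    rewrite (basis_comb_coord onb _ (fun k => wiener_sum w (coord_increments e k (psi
      (n, k))) x)).
    by case: ifP; rewrite ?mul1r ?mul0r.
  have mJD n k : measurable_fun setT (fun x => L2_inner (J x - elementary_integral W
    (Psi n) x) (e k)).
    by under eq_fun do rewrite JD; apply: measurable_funB => //; exact: measurable_funM.
  have -> : (fun n => mean_square_norm P (fun x => J x - elementary_integral W (Psi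
    n) x)) =
      (fun n => \sum_(0 <= k <oo) (L2_norm (D n k) ^+ 2)%:E)%E.
    apply/funext => n; rewrite (mean_square_norm_series onb)//.
    apply: eq_eseriesr => k _; rewrite EFin_L2_norm_sqr; apply: ae_eq_integral => //.
    - by apply/measurable_EFinP; exact: measurable_funX.
    - by apply/measurable_EFinP; exact: measurable_funX.
    - by apply: filterS (a'_ae k) => x a'x _; rewrite JD a'x.
  apply: (cvg_split_series (y := fun k => lam k * L2_norm (F k) ^+ 2)) => //.
  + by move=> n k; rewrite sqr_ge0.
  + by move=> n k kn; rewrite /D kn scale1r; have [] := psiP (n, k).
  + move=> n k nk; rewrite /D ltnNge nk/= scale0r subr0 L2_normZ exprMn FU.
    by rewrite real_normK ?num_real// sqr_sqrtr// ltW.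
Qed.

End stochastic_integral_existence.

(** * The Gamma integral and power sums *)

Section affine_substitution.
Variable R : realType.
Local Notation leb := (@lebesgue_measure R).

(** The image of Lebesgue measure under x |-> b - a x, scaled by a, is Lebesgue measure, as seen on
    the intervals ]u, v]; the reflection makes their preimages closed on the left. *)
Lemma ge0_integral_affine (a b : R) (g : measurableTypeR R -> \bar R) :
  0 < a -> measurable_fun setT g -> (forall x, 0 <= g x)%E ->
  (\int[leb]_x g (b - a * x)%R = (a^-1)%:E * \int[leb]_x g x)%E.
Proof.
move=> a0 mg g0.
pose phi0 (x : measurableTypeR R) : measurableTypeR R := b - a * x.
have mphi : measurable_fun setT phi0.
  by apply: measurable_funB => //; exact: measurable_funM.
pose nu := mscale (NngNum (ltW a0)) (pushforward leb phi0).
have nuE A : measurable A -> leb A = nu mphi A.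
  apply: lebesgue_measure_unique => _ [[u v] _ <-].
  have E : phi0 @^-1` `]u, v] = [set` `[(b - v) / a, (b - u) / a[].
    apply/seteqP; split => x /=; rewrite !in_itv/= /phi0 => /andP[h1 h2];
      apply/andP; split.
    - by rewrite ler_pdivrMr//; lra.
    - by rewrite ltr_pdivlMr//; lra.
    - by move: h2; rewrite ltr_pdivlMr// => h2; lra.
    - by move: h1; rewrite ler_pdivrMr// => h1; lra.
  have nuE : nu mphi `]u, v]%classic = (a%:E * leb (phi0 @^-1` `]u, v]))%E by [].
  rewrite [RHS]nuE E !lebesgue_measure_itv/= !lte_fin ltr_pM2r ?invr_gt0// ltrD2l ltrN2.
  case: ifP => _; last by rewrite mule0.
  rewrite -!EFinB -EFinM; congr EFin; field; by rewrite gt_eqF.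
rewrite [in RHS](eq_measure_integral (nu mphi)); last by move=> A mA _; exact: nuE.
rewrite ge0_integral_mscale//= muleA -EFinM mulVf ?gt_eqF// mul1e.
by rewrite ge0_integral_pushforward//= preimage_setT.
Qed.

End affine_substitution.

Section gamma_integral.
Variable R : realType.
Local Notation leb := (@lebesgue_measure R).
Implicit Types a b p x y : R.

Lemma continuous_powR_gt0 p x : 0 < x -> {for x, continuous (@powR R ^~ p)}.
Proof.
move=> x0; apply: differentiable_continuous; apply/derivable1_diffP.
by apply: derivable_powR; rewrite in_itv/= andbT.
Qed.

Lemma integral_powR a b p : 0 < a -> a < b -> p != 0 ->
  (\int[leb]_(x in `[a, b]) (x `^ (p - 1))%:E = ((b `^ p - a `^ p) / p)%:E)%E.
Proof.
move=> a0 ab p0; have b0 := lt_trans a0 ab.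
pose F x := p^-1 * x `^ p.
have cF x : 0 < x -> {for x, continuous F}.
  by move=> x0; apply: continuousM; [exact: cst_continuous|exact: continuous_powR_gt0].
rewrite (@continuous_FTC2 _ _ F)//.
- by rewrite /F -EFinB; congr EFin; rewrite mulrBl ![_ / p]mulrC.
- apply: continuous_in_subspaceT => x; rewrite inE/= in_itv/= => /andP[ax _].
  exact: continuous_powR_gt0 (lt_le_trans a0 ax).
- split.
  + move=> x; rewrite in_itv/= => /andP[ax _]; apply: derivableM => //.
    by apply: derivable_powR; rewrite in_itv/= andbT (lt_trans a0).
  + by apply: cvg_at_right_filter; exact: cF.
  + by apply: cvg_at_left_filter; exact: cF.
- move=> x; rewrite in_itv/= => /andP[ax _]; have x0 := lt_trans a0 ax.
  have dp := is_derive1_powR p x0.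
  rewrite derive1E /F deriveZ//= derive_val.
  by rewrite /GRing.scale/= mulrA mulVf// mul1r.
Qed.

Definition gamma_fun (beta x : R) := x `^ (beta - 1) * expR (- x).

Lemma gamma_fun_ge0 beta x : 0 <= gamma_fun beta x.
Proof. by rewrite mulr_ge0 ?powR_ge0 ?expR_ge0. Qed.

Lemma measurable_gamma_fun beta (D : set R) : measurable_fun D (gamma_fun beta).
Proof.
apply: measurable_funTS; apply: measurable_funM; first exact: measurable_powR.
by apply: measurableT_comp => //; exact: measurableT_comp.
Qed.

(** Split at 1: the integrand is at most x^(beta - 1) before 1, with integral at most 1 / beta, and
    at most K x^(-2) after 1, with integral at most K. *)
Lemma gamma_integral_lty beta : 0 < beta ->
  (\int[leb]_(x in `]0%R, +oo[) (gamma_fun beta x)%:E < +oo)%E.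
Proof.
move=> beta0.
have [n nbeta] : exists n : nat, beta <= n%:R.
  by exists (Num.truncn beta).+1; rewrite ltW// truncnS_gt.
pose K : R := n.+1`!%:R.
have K0 : 0 < K by rewrite ltr0n fact_gt0.
have small x : 0 < x -> gamma_fun beta x <= x `^ (beta - 1).
  move=> x0; rewrite /gamma_fun ler_piMr ?powR_ge0//.
  by rewrite -expR0 ler_expR oppr_le0 ltW.
(* From exp x >= x^(n + 1) / (n + 1)! with n >= beta. The exponent [-1 - 1] fits [integral_powR] at
   p = -1. *)
have large x : 1 <= x -> gamma_fun beta x <= K * x `^ (-1 - 1).
  move=> x1; have x0 : 0 < x by exact: lt_le_trans x1.
  have h : expR (- x) <= K * x `^ (- n.+1%:R).
    rewrite expRN (powR_invn _ (ltW x0)) -[leRHS]invrK lef_pV2 ?posrE ?expR_gt0//;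
      last first.
      by rewrite invr_gt0 mulr_gt0// invr_gt0 exprn_gt0.
    rewrite invfM invrK mulrC; have := expR_ge1Dxn n (ltW x0).
    by apply: le_trans; rewrite lerDr.
  apply: le_trans (ler_wpM2l (powR_ge0 _ _) h) _.
  rewrite mulrCA ler_pM2l// -powRD; last by rewrite (gt_eqF x0) implybT.
  by apply: ler_powR => //; rewrite -natr1; lra.
(* The shift by 2 keeps 1 strictly inside each interval. *)
pose E (k : nat) : set R := `[k.+2%:R^-1, k.+2%:R]%classic.
have eps0 k : 0 < k.+2%:R^-1 :> R by rewrite invr_gt0.
have eps1 k : k.+2%:R^-1 < 1 :> R by rewrite invf_lt1// ltr1n.
have N1 k : 1 < k.+2%:R :> R by rewrite ltr1n.
have EE : `]0, +oo[%classic = \bigcup_k E k.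
  apply/seteqP; split => x /=.
    rewrite in_itv/= andbT => x0.
    have x0' : 0 < x^-1 by rewrite invr_gt0.
    exists (maxn (Num.truncn x) (Num.truncn x^-1)) => //.
    rewrite /E/= in_itv/=; apply/andP; split.
      rewrite -[leRHS]invrK lef_pV2 ?posrE// (le_trans (ltW (truncnS_gt _)))//.
      by rewrite ler_nat ltnS (leq_trans (leq_maxr _ _) (leqnSn _)).
    rewrite (le_trans (ltW (truncnS_gt _)))//.
    by rewrite ler_nat ltnS (leq_trans (leq_maxl _ _) (leqnSn _)).
  move=> [k _]; rewrite /E/= !in_itv/= andbT => /andP[kx _].
  exact: lt_le_trans kx.
have bound k : (\int[leb]_(x in E k) (gamma_fun beta x)%:E <= (beta^-1 + K)%:E)%E.
  have -> : E k = `[k.+2%:R^-1, 1[%classic `|` `[1, k.+2%:R]%classic.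
    by rewrite /E -itv_bndbnd_setU//= bnd_simp ?ltW.
  rewrite ge0_integral_setU//=; last 3 first.
  - by apply/measurable_EFinP; exact: measurable_gamma_fun.
  - by move=> x _; rewrite lee_fin gamma_fun_ge0.
  - apply/disj_setPS => x [/=]; rewrite !in_itv/= => /andP[_ x1] /andP[x1' _].
    by have := lt_le_trans x1 x1'; rewrite ltxx.
  rewrite EFinD; apply: leeD.
    apply: (@le_trans _ _ (\int[leb]_(x in `[k.+2%:R^-1%R, 1%R]) (x `^ (beta -
      1))%:E)%E).
      apply: (@le_trans _ _ (\int[leb]_(x in `[k.+2%:R^-1%R, 1%R[) (x `^ (beta -
        1))%:E)%E).
        apply: ge0_le_integral_lower => x /=; rewrite in_itv/= => /andP[kx _].
          by rewrite lee_fin gamma_fun_ge0.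
        by rewrite lee_fin small// (lt_le_trans _ kx).
      apply: ge0_subset_integral => //.
      + by apply/measurable_EFinP; apply: measurable_funTS; exact: measurable_powR.
      + by move=> x _; rewrite lee_fin powR_ge0.
      + by move=> x /=; rewrite !in_itv/= => /andP[-> /ltW ->].
    rewrite integral_powR ?(lt0r_neq0 beta0)// lee_fin powR1 ler_pdivrMr// (mulVf
      (lt0r_neq0 beta0)).
    by rewrite gerBl powR_ge0.
  apply: (@le_trans _ _ (\int[leb]_(x in `[1%R, k.+2%:R]) (K%:E * (x `^ (-1 -
    1))%:E))%E).
    apply: ge0_le_integral_lower => x /=; rewrite in_itv/= => /andP[x1 _].
      by rewrite lee_fin gamma_fun_ge0.
    by rewrite -EFinM lee_fin large.
  rewrite ge0_integralZl_EFin//; last 2 first.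
  - by move=> x _; rewrite lee_fin powR_ge0.
  - by apply/measurable_EFinP; apply: measurable_funTS; exact: measurable_powR.
  rewrite integral_powR ?oppr_eq0 ?oner_eq0// -EFinM lee_fin powR1 ler_piMr// ?(ltW
    K0)//.
  by rewrite invrN invr1 mulrN1 opprB gerBl powR_ge0.
rewrite EE; apply: le_lt_trans (ltry (beta^-1 + K)).
have ndE : nondecreasing_seq E.
  move=> i j ij; apply/subsetPset => x; rewrite /E/= !in_itv/= => /andP[h1 h2].
  apply/andP; split.
    by apply: le_trans h1; rewrite lef_pV2 ?posrE// ler_nat !ltnS.
  by rewrite (le_trans h2)// ler_nat !ltnS.
have cv : (\int[leb]_(x in E k) (gamma_fun beta x)%:E)%E @[k --> \oo] -->
    (\int[leb]_(x in \bigcup_k E k) (gamma_fun beta x)%:E)%E.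
  apply: (@ge0_nondecreasing_set_cvg_integral _ (measurableTypeR R)) => //.
  - by move=> i; exact: measurable_itv.
  - by move=> i; apply/measurable_EFinP; exact: measurable_gamma_fun.
  - by move=> i x _; rewrite lee_fin gamma_fun_ge0.
rewrite -(cvg_lim _ cv)//; apply: lime_le; last exact: nearW.
by apply/cvg_ex; eexists; exact: cv.
Qed.

Lemma EFin_Gamma beta : 0 < beta ->
  (Gamma beta)%:E = (\int[leb]_(x in `]0%R, +oo[) (gamma_fun beta x)%:E)%E.
Proof.
move=> beta0; rewrite /Gamma /Rintegral fineK// ge0_fin_numE.
  exact: gamma_integral_lty.
by apply: integral_ge0 => x _; rewrite lee_fin gamma_fun_ge0.
Qed.

Lemma Gamma_ge0 beta : 0 <= Gamma beta :> R.
Proof. by apply: Rintegral_ge0 => x _; exact: gamma_fun_ge0. Qed.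

(** With u = t - s the squared kernel is exp(- 2 m u) u^(2 gamma - 2). One factor exp(- m u) is
    bounded by 1, and x = m u turns the rest into the integrand of Gamma(2 gamma - 1), over a part
    of ]0, +oo[. *)
Lemma integral_kernel_sqr_le (gamma m t : R) : 1 / 2 < gamma -> 0 < m ->
  (\int[leb]_(s in `[0%R, t])
     ((expR (- (m * (t - s))) * (t - s) `^ (gamma - 1)) ^+ 2)%:E
   <= (Gamma (2 * gamma - 1) / m `^ (2 * gamma - 1))%:E)%E.
Proof.
move=> gamma2 m0; set beta := 2 * gamma - 1; have beta0 : 0 < beta by rewrite /beta;
  lra.
pose h : measurableTypeR R -> \bar R := (fun x : R => (gamma_fun beta x)%:E) \_ `]0,
  +oo[.
have mh : measurable_fun setT h.
  apply/(measurable_restrictT _ _).1 => //.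
  by apply/measurable_EFinP; exact: measurable_gamma_fun.
have h0 x : (0 <= h x)%E.
  by rewrite /h patchE; case: ifP => // _; rewrite lee_fin gamma_fun_ge0.
have hG : (\int[leb]_x h x = (Gamma beta)%:E)%E.
  by rewrite EFin_Gamma// [RHS]integral_mkcond.
(* The endpoint s = t is dropped: for gamma = 1 the kernel is 1 there, since 0 to the power 0 is 1,
   while [h] vanishes at 0. *)
rewrite -integral_itv_bndo_bndc; last first.
  apply/measurable_EFinP; apply: measurable_funX; apply: measurable_funM.
    apply: measurableT_comp => //; apply: measurableT_comp => //.
    by apply: measurable_funM => //; exact: measurable_funB.
  apply: (measurableT_comp (measurable_powR _)); exact: measurable_funB.
(* From u^(beta - 1) = m^(1 - beta) (m u)^(beta - 1); the Jacobian 1 / m completes the power m^(-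
   beta). *)
apply: (@le_trans _ _ (\int[leb]_s ((m `^ (1 - beta))%:E * h (m * t - m * s)%R))%E).
  rewrite integral_mkcond; apply: ge0_le_integral_lower => s _.
    by rewrite patchE; case: ifP => // _; rewrite lee_fin sqr_ge0.
  rewrite patchE; case: ifPn => [|_]; last first.
    by rewrite mule_ge0// lee_fin powR_ge0.
  rewrite inE/= in_itv/= => /andP[_ st].
  have u0 : 0 < t - s by rewrite subr_gt0.
  rewrite -mulrBr /h patchE ifT; last by rewrite inE/= in_itv/= andbT mulr_gt0.
  rewrite -EFinM lee_fin /gamma_fun; set u := t - s in u0 *.
  rewrite powRM ?(ltW m0) ?(ltW u0)// !mulrA -powRD;
    last by rewrite (gt_eqF m0) implybT.
  rewrite (_ : 1 - beta + (beta - 1) = 0); last by ring.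
  rewrite powRr0 mul1r exprMn mulrC; apply: ler_pM.
  - exact: sqr_ge0.
  - exact: sqr_ge0.
  - rewrite -[_ ^+ 2]powR_mulrn ?powR_ge0// -powRrM.
    by rewrite (_ : (gamma - 1) * 2%:R = beta - 1)//; rewrite /beta; ring.
  - rewrite expr2 ler_piMl ?expR_ge0// -[leRHS]expR0 ler_expR oppr_le0.
    by rewrite mulr_ge0// ltW.
have mh' : measurable_fun setT (fun s : measurableTypeR R => h (m * t - m * s)).
  have maff : measurable_fun setT (fun s : measurableTypeR R => m * t - m * s :
    measurableTypeR R).
    by apply: measurable_funB => //; exact: measurable_funM.
  exact: (measurableT_comp mh maff).
rewrite (ge0_integralZl_EFin _ _ _ mh' (powR_ge0 _ _))//.
rewrite ge0_integral_affine// hG -!EFinM lee_fin le_eqVlt; apply/orP; left; apply/eqP.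
rewrite powRB; last by rewrite (gt_eqF m0) implybT.
rewrite powRr1 ?(ltW m0)//; field.
by rewrite !gt_eqF ?powR_gt0.
Qed.

End gamma_integral.

Section power_tail.
Variable R : realType.

(** The right-hand side is the integral of x^(- (p + 1)) over [k, k + 1]. With n = k + 1 the claim
    becomes (1 - 1/n)^(- p) >= 1 + p / n, a consequence of ln (1 - 1/n) <= - 1/n and exp x >= 1 +
    x. *)
Lemma powR_decrement_ge (p : R) (k : nat) : 0 < p -> (0 < k)%N ->
  k.+1%:R `^ (- (p + 1)) <= (k%:R `^ (- p) - k.+1%:R `^ (- p)) / p.
Proof.
move=> p0 k0; have kR : 0 < k%:R :> R by rewrite ltr0n.
set n : R := k.+1%:R; have n0 : 0 < n by rewrite ltr0n.
have kn : k%:R = n - 1 by rewrite /n -natr1 addrK.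
rewrite ler_pdivlMr//.
have -> : n `^ (- (p + 1)) = n `^ (- p) / n.
  by rewrite opprD powRD ?powR_inv1 ?(ltW n0)// (gt_eqF n0) implybT.
have u1 : - 1 < - n^-1 by rewrite ltrN2 invf_lt1// /n ltr1n ltnS.
have q0 : 0 < 1 - n^-1 by rewrite subr_gt0 -ltrN2.
have -> : k%:R = n * (1 - n^-1) by rewrite mulrBr mulr1 mulfV ?gt_eqF// kn.
rewrite powRM ?(ltW n0) ?(ltW q0)//.
have h : 1 + p * n^-1 <= (1 - n^-1) `^ (- p).
  rewrite /powR gt_eqF//; apply: le_trans (expR_ge1Dx _).
  by rewrite lerD2l mulNr -mulrN ler_pM2l// lerNr; exact: le_ln1Dx.
have := ler_wpM2l (powR_ge0 n (- p)) h.
move: (n `^ (- p)) ((1 - n^-1) `^ (- p)) => a b.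
by rewrite mulrDr mulr1 lerBrDl -[a / n * p]mulrA [n^-1 * p]mulrC.
Qed.

(** The decrements of [powR_decrement_ge] telescope; M > 0 keeps its index positive. *)
Lemma powR_tail_sum (p : R) (M : nat) : 0 < p -> (0 < M)%N ->
  (\sum_(M <= k <oo) (k.+1%:R `^ (- (p + 1)))%:E <= (M%:R `^ (- p) / p)%:E)%E.
Proof.
move=> p0 M0; rewrite -[leLHS]nneseries_addn; last first.
  by move=> k; rewrite lee_fin powR_ge0.
apply: nneseries_le => [k|n]; first by rewrite lee_fin powR_ge0.
rewrite sumEFin lee_fin.
suff : \sum_(k < n) (k + M).+1%:R `^ (- (p + 1)) <=
    (M%:R `^ (- p) - (n + M)%:R `^ (- p)) / p.
  move=> /le_trans; apply; rewrite ler_pM2r ?invr_gt0//.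
  by rewrite gerBl powR_ge0.
elim: n => [|n IH]; first by rewrite big_ord0 add0n subrr mul0r.
rewrite big_ord_recr/= addSn.
have := @powR_decrement_ge p (n + M) p0; rewrite addn_gt0 M0 orbT => /(_ isT) h.
apply: le_trans (lerD IH h) _.
by rewrite -mulrDl addrA subrK.
Qed.

End power_tail.

(** * Truncation error *)

Section truncation_error.
Context d (T : measurableType d) (R : realType).
Variable mu : {measure set T -> \bar R}.
Variable e : nat -> L2 mu.
Hypothesis onb : orthonormal_basis e.
Context dO (Omega : measurableType dO) (P : probability Omega R).

(** Coordinates below M cancel only almost surely, so the terms are compared under the integral
    rather than pointwise. *)
Lemma mean_square_truncation (X : Omega -> L2 mu) (c : nat -> Omega -> R) (M : nat) :
  L2_measurable X -> (forall k, measurable_fun setT (c k)) ->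
  (forall k, (fun w => L2_inner (X w) (e k)) = c k %[ae P]) ->
  (mean_square_norm P (fun w => (X w - \sum_(k < M) c k w *: e k)%R) =
   \sum_(M <= k <oo) \int[P]_w (c k w ^+ 2)%:E)%E.
Proof.
move=> mX mc Xc.
have coordE k w : L2_inner (X w - \sum_(k < M) c k w *: e k) (e k) =
    L2_inner (X w) (e k) - (if (k < M)%N then c k w else 0).
  by rewrite L2_innerBl (basis_comb_coord onb M (c ^~ w)).
have mcoord k : measurable_fun setT
    (fun w => L2_inner (X w - \sum_(k < M) c k w *: e k) (e k)).
  under eq_fun do rewrite coordE.
  apply: measurable_funB; first exact: measurable_L2_inner.
  by case: (k < M)%N.
rewrite (mean_square_norm_series onb)// (nneseries_split 0 M); last first.
  by move=> k _; apply: integral_ge0 => w _; rewrite lee_fin sqr_ge0.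
have termE k : (\int[P]_w (L2_inner (X w - \sum_(k < M) c k w *: e k) (e k) ^+ 2)%:E =
    \int[P]_w ((if (k < M)%N then 0 else c k w) ^+ 2)%:E)%E.
  apply: ae_eq_integral => //.
  - by apply/measurable_EFinP; exact: measurable_funX.
  - by apply/measurable_EFinP; apply: measurable_funX; case: (k < M)%N.
  - apply: filterS (Xc k) => w /(_ I) Xcw _; rewrite coordE Xcw.
    by case: ifP; rewrite ?subrr ?subr0.
rewrite add0n big_mkord big1 ?add0e; last first.
  move=> k _; rewrite termE ltn_ord.
  by under eq_integral do rewrite expr0n; exact: integral0.
rewrite eseries_cond [RHS]eseries_cond; apply: eq_eseriesr => k /andP[_ Mk].
by rewrite termE ltnNge Mk.
Qed.

Lemma L2_measurable_scale (a : R) (X : Omega -> L2 mu) :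
  L2_measurable X -> L2_measurable (fun w => a *: X w).
Proof.
move=> mX; apply: (L2_measurable_coord onb) => k.
under eq_fun do rewrite L2_innerZl.
by apply: measurable_funM => //; exact: measurable_L2_inner.
Qed.

End truncation_error.

(** * Convergence rate of the truncated stochastic convolution *)

Unset Implicit Arguments.

Theorem theorem3p1 (R : realType) (gamma T : R) (d : nat)
    (D : set (d.-tuple R)) (mD : measurable D)
    (domA : set (L2 (lebesgue_on mD))) (A Q : L2 (lebesgue_on mD) -> L2 (lebesgue_on mD))
    (S : R -> L2 (lebesgue_on mD) -> L2 (lebesgue_on mD))
    (* indices start at 0: mu k, lam k, e k, c k stand for mu_(k+1), etc *)
    (e : nat -> L2 (lebesgue_on mD)) (mu lam : nat -> R)
    (r_mu r_lam C1 C2 : R)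
    (dO : measure_display) (Omega : measurableType dO) (P : probability Omega R)
    (W : R -> L2 (lebesgue_on mD) -> Omega -> R) (c : nat -> R -> Omega -> R)
    (nu := - (d%:R / 2) * (1 + r_lam - (2 * gamma - 1) * r_mu))
    (C := C2 * Gamma (2 * gamma - 1) / (C1 `^ (2 * gamma - 1) * Gamma gamma ^+ 2)
          * (d%:R / (2 * nu))) :
  1 / 2 < gamma -> 0 < T -> (0 < d)%N ->
  linear_operator domA A -> linear_operator setT Q ->
  orthonormal_basis e ->
  (forall k, eigenvector domA A (mu k) (e k)) ->
  (forall k, eigenvector setT Q (lam k) (e k)) ->
  0 < r_mu -> 0 < C1 -> (forall k, C1 * k.+1%:R `^ r_mu <= mu k) ->
  nondecreasing_seq mu ->
  r_lam < 0 -> 0 < C2 -> (forall k, 0 < lam k <= C2 * k.+1%:R `^ r_lam) ->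
  nonincreasing_seq lam ->
  C0_semigroup S ->
  (forall t k, 0 <= t -> S t (e k) = expR (- (mu k * t)) *: e k %[ae lebesgue_on mD]) ->
  generalised_Q_wiener P Q W ->
  (forall k t, 0 <= t -> spectral_coefficient P gamma mu lam e W k t (c k t)) ->
  1 + r_lam - (2 * gamma - 1) * r_mu < 0 ->
  forall t, 0 <= t <= T ->
    (exists X, stochastic_convolution P gamma S e lam W t X) /\
    forall X, stochastic_convolution P gamma S e lam W t X ->
      [/\ L2_random P X,
          mean_square_norm P (fun w => X w - spectral_truncation e c M t w)
            @[M --> \oo] --> 0%E &
          forall M, (1 <= M)%N ->
            (mean_square_norm P (fun w => (X w - spectral_truncation e c M t w)%R)
             <= (C * M%:R `^ (- (2 * nu / d%:R)))%:E)%E].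
Proof.
move=> gamma2 _ d0 _ _ onb _ eQ _ C10 mu_ge _ _ C20 lam_bd _ _ HSe HW Hc neg t
  /andP[t0 _].
pose beta := 2 * gamma - 1.
have beta0 : 0 < beta by rewrite /beta; lra.
(* This is 2 nu / d, so the dimension cancels from the exponent of M and from d / (2 nu) = 1 / p. *)
pose p := - (1 + r_lam - beta * r_mu).
have p0 : 0 < p by rewrite oppr_gt0 /beta.
have dR : (d%:R : R) != 0 by rewrite pnatr_eq0 -lt0n.
have nuE : 2 * nu = d%:R * p by rewrite /nu /p /beta; field.
have lam0 k : 0 < lam k by case/andP : (lam_bd k).
have Qe k : Q (e k) = lam k *: e k %[ae lebesgue_on mD] by case: (eQ k).
have [w [wE w_cov]] := wiener_L2 HW.
pose f k s := expR (- (mu k * (t - s))) * (t - s) `^ (gamma - 1).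
have /choice[I IP] : forall k, exists I : Omega -> R,
    wiener_integral P (coordinate_wiener W e lam k) t (f k) I /\
    forall w, c k t w = Num.sqrt (lam k) / Gamma gamma * I w.
  by move=> k; have [I ? ?] := Hc k t t0; exists I.
have I_int k := (IP k).1; have cE k := (IP k).2.
pose Phi s (x : L2 (lebesgue_on mD)) := (t - s) `^ (gamma - 1) *: S (t - s) x.
have Phi_e s k : 0 <= s <= t -> Phi s (e k) = f k s *: e k %[ae lebesgue_on mD].
  move=> /andP[_ st]; have ts0 : 0 <= t - s by rewrite subr_ge0.
  apply: filterS (HSe _ k ts0) => x /(_ Logic.I) h _.
  transitivity ((t - s) `^ (gamma - 1) * S (t - s) (e k) x) => //.
  by rewrite h mulrA [_ * expR _]mulrC.
pose v k := (\int[lebesgue_measure]_(s in `[0%R, t]) (f k s ^+ 2)%:E)%E.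
have v0 k : (0 <= v k)%E by apply: integral_ge0 => s _; rewrite lee_fin sqr_ge0.
(* The constant C without its factors Gamma(gamma)^-2 and 1 / p. *)
pose K := C2 * Gamma beta / C1 `^ beta.
have K0 : 0 <= K by rewrite divr_ge0 ?powR_ge0// mulr_ge0 ?Gamma_ge0// ltW.
have v_le k : ((lam k)%:E * v k <= (K * k.+1%:R `^ (- (p + 1)))%:E)%E.
  have kmu : 0 < C1 * k.+1%:R `^ r_mu by rewrite mulr_gt0// powR_gt0.
  have mu0 : 0 < mu k by apply: lt_le_trans (mu_ge k).
  apply: le_trans (lee_wpmul2l _ (integral_kernel_sqr_le t gamma2 mu0)) _.
    by rewrite lee_fin ltW.
  rewrite -EFinM lee_fin -/beta.
  apply: (@le_trans _ _ (C2 * k.+1%:R `^ r_lam * (Gamma beta / (C1 * k.+1%:R `^ r_mu)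
    `^ beta))).
    apply: ler_pM; first exact: ltW.
    - by rewrite divr_ge0 ?Gamma_ge0 ?powR_ge0.
    - by case/andP : (lam_bd k).
    - apply: ler_wpM2l; first exact: Gamma_ge0.
      by rewrite lef_pV2 ?posrE ?powR_gt0// ge0_ler_powR ?nnegrE// ltW.
  rewrite powRM ?powR_ge0 ?(ltW C10)// -powRrM /K.
  have -> : - (p + 1) = r_lam - r_mu * beta by rewrite /p; ring.
  rewrite powRD; last by rewrite (gt_eqF (ltr0Sn _ k)) implybT.
  rewrite powRN le_eqVlt; apply/orP; left; apply/eqP; field.
  by rewrite !gt_eqF ?powR_gt0.
have tail_le M : (0 < M)%N -> (\sum_(M <= k <oo) ((lam k)%:E * v k) <= (K * (M%:R `^
  (- p) / p))%:E)%E.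
  move=> M0.
  apply: (@le_trans _ _ (\sum_(M <= k <oo) (K%:E * (k.+1%:R `^ (- (p + 1)))%:E))%E).
    apply: lee_nneseries => [k _ _|k _]; first by rewrite mule_ge0// lee_fin ltW.
    by rewrite -EFinM.
  rewrite nneseriesZl; last by move=> k _; rewrite lee_fin powR_ge0.
  by rewrite [leRHS]EFinM; apply: lee_wpmul2l; [rewrite lee_fin|exact: powR_tail_sum].
have f_sum : (\sum_(0 <= k <oo) ((lam k)%:E * v k) < +oo)%E.
  (* The tail bound requires M >= 1, so the term k = 0 is split off. *)
  rewrite (nneseries_split 0 1); last by move=> k _; rewrite mule_ge0// lee_fin ltW.
  rewrite add0n big_nat1; apply: lte_add_pinfty.
    by apply: le_lt_trans (v_le 0) _; exact: ltry.
  by apply: le_lt_trans (tail_le 1 isT) _; exact: ltry.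
split.
  have [J HJ] := exists_stochastic_integral onb Qe lam0 wE w_cov I_int Phi_e f_sum.
  by exists (fun x => (Gamma gamma)^-1 *: J x); exists J.
move=> X [J HJ XE].
have JE := stochastic_integral_coord onb Qe lam0 wE w_cov I_int Phi_e HJ.
have mX : L2_measurable X.
  rewrite (_ : X = fun x => (Gamma gamma)^-1 *: J x); last exact/funext.
  exact: (L2_measurable_scale onb _ (JE 0).1).
have mc k : measurable_fun setT (c k t).
  rewrite (_ : c k t = fun x => Num.sqrt (lam k) / Gamma gamma * I k x);
    last exact/funext.
  by apply: measurable_funM => //; case: (I_int k).
have Xc k : (fun x => L2_inner (X x) (e k)) = c k t %[ae P].
  apply: filterS (JE k).2 => x /(_ Logic.I) h _.
  by rewrite XE cE L2_innerZl h mulrA [_^-1 * _]mulrC.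
have c2 k : (\int[P]_x (c k t x ^+ 2)%:E = ((Gamma gamma ^+ 2)^-1)%:E * ((lam k)%:E *
  v k))%E.
  have [F [U [phi [FE UE _ _ [_ UF]]]]] := wiener_integral_L2 onb Qe lam0 wE w_cov
    (I_int k).
  rewrite (EFin_L2_norm_fun_sqr (f := (Num.sqrt (lam k) / Gamma gamma) *: U));
    last first.
    by move=> x; rewrite cE -UE.
  have -> : v k = (L2_norm F ^+ 2)%:E.
    rewrite EFin_L2_norm_sqr /v [LHS]integral_mkcond; apply: eq_integral => s _.
    by rewrite FE !patchE; case: ifP; rewrite ?expr0n.
  rewrite L2_normZ UF exprMn real_normK ?num_real// exprMn sqr_sqrtr ?(ltW (lam0 k))//.
  by rewrite -!EFinM exprVn mulrA [_^-1 * _]mulrC.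
(* An exact identity, valid also at M = 0: the finite second moment of X, the convergence and the
   rate are all read off it. *)
have errE M : mean_square_norm P (fun x => X x - spectral_truncation e c M t x) =
    (((Gamma gamma ^+ 2)^-1)%:E * \sum_(M <= k <oo) ((lam k)%:E * v k))%E.
  rewrite -nneseriesZl; last by move=> k _; rewrite mule_ge0// lee_fin ltW.
  rewrite (mean_square_truncation onb M mX mc Xc).
  by apply: eq_eseriesr => k _; exact: c2.
have err_le M : (1 <= M)%N ->
    (mean_square_norm P (fun x => (X x - spectral_truncation e c M t x)%R)
     <= (C * M%:R `^ (- (2 * nu / d%:R)))%:E)%E.
  move=> M0; rewrite errE.
  apply: le_trans (lee_wpmul2l _ (tail_le M M0)) _.
    by rewrite lee_fin invr_ge0 sqr_ge0.
  rewrite -EFinM lee_fin /C -/beta nuE [d%:R * p / _]mulrAC mulfV// mul1r.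
  rewrite [(d%:R * p)^-1]invfM [d%:R * _]mulrA (mulfV dR) mul1r /K.
  rewrite [(C1 `^ beta * _)^-1]invfM le_eqVlt; apply/orP; left; apply/eqP; ring.
split => //.
- split => //.
  (* X is its own truncation error at M = 0. *)
  rewrite (_ : X = fun x => X x - spectral_truncation e c 0 t x); last first.
    by apply/funext => x; rewrite /spectral_truncation big_ord0 subr0.
  rewrite errE lte_mul_pinfty// lee_fin invr_ge0 sqr_ge0//.
- have -> : (fun M => mean_square_norm P (fun x => X x - spectral_truncation e c M t
  x)) =
      (fun M => ((Gamma gamma ^+ 2)^-1)%:E * \sum_(M <= k <oo) ((lam k)%:E * v k))%E.
    exact/funext.
  have tail0 : (\sum_(M <= k <oo) ((lam k)%:E * v k))%E @[M --> \oo] --> 0%E.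
    apply: (@nneseries_tail_cvg _ (fun k => (lam k)%:E * v k)%E xpredT f_sum) => k _.
    by rewrite mule_ge0// lee_fin ltW.
  have G0 : ((Gamma gamma ^+ 2)^-1)%:E \is a fin_num by [].
  by move: (cvgeZl G0 tail0); rewrite mule0.
Qed.
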